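(* Let $Q=[0,1]^2$ and let $u$ be continuous on $Q$ and affine on each triangle of a finite triangulation $\mathcal D$ of $Q$. Then the distribution $\mathbf m_u$ is a measure concentrated on the $1$-skeleton of $\mathcal D$, and $$|\mathbf m_u|(\mathring Q)=\mathcal E_{\mathbf H}(P),$$ where $P$ is the polyhedral surface given by the graph of $u$.
   Context: $\nu_u=(\nu^1_u,\nu^2_u,\nu^3_u):=g_u^{-1/2}(-\partial_1u,-\partial_2u,1)$, $g_u:=1+|\nabla u|^2$, is the unit normal (defined a.e.), and $\sigma^j_u:=(-\nu_u^j\,\partial_2u,\ \nu_u^j\,\partial_1u)$, $j=1,2,3$. For an $L^1$ vector field $\sigma:Q\to\mathbb R^2$, the distributional divergence is $\langle\mathrm{Div}\,\sigma,\varphi\rangle:=-\int_Q\sigma\bullet\nabla\varphi\,dx$, $\varphi\in C^\infty_c(\mathring Q)$, with $\mathring Q$ the interior of $Q$. The vector-valued distribution $\mathbf m_u$ is $\mathbf m_u:=(\mathbf m_u^1,\mathbf m_u^2,\mathbf m_u^3)$ with $\mathbf m_u^j:=(D\nu_u^j,\mathrm{Div}\,\sigma^j_u)$, where $D\nu_u^j$ is the distributional gradient ($\mathbf m_u$ thus takes values in $\mathbb R^9$ and $|\mathbf m_u|$ is its total variation with respect to the Euclidean norm). The mean curvature energy is $\mathcal E_{\mathbf H}(P):=\sum_e\mathcal L(e)\cdot2\sin(\theta_e/2)$, sum over the edges $e$ of $P$ (shared by two faces), where $\mathcal L(e)$ is the length of $e$ and $\theta_e$ the exterior dihedral angle of $P$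 along $e$ (the angle between the unit normals of the two faces meeting at $e$). *)

(* Defs.v *)
From HB Require Import structures.
From mathcomp Require Import all_boot all_order all_algebra.
From mathcomp Require Import all_classical all_reals all_analysis.

Set Implicit Arguments.
Unset Strict Implicit.
Unset Printing Implicit Defensive.

Import Order.TTheory GRing.Theory Num.Theory numFieldNormedType.Exports.

Local Open Scope classical_set_scope.
Local Open Scope ring_scope.

Section Plane.
Context {R : realType}.

Definition square : set (R * R) := `[0, 1] `*` `[0, 1].

Definition lebesgue2 :
    {measure set (measurableTypeR R * measurableTypeR R) -> \bar R} :=
  (@lebesgue_measure R \x @lebesgue_measure R)%E.

Definition partial1 (f : R * R -> R) (x : R * R) : R := 'D_(1, 0) f x.
Definition partial2 (f : R * R -> R) (x : R * R) : R := 'D_(0, 1) f x.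

Fixpoint of_class_C (n : nat) (f : R * R -> R) : Prop :=
  continuous f /\
  if n is n'.+1 then
    (forall x, derivable f x (1, 0) /\ derivable f x (0, 1)) /\
    of_class_C n' (partial1 f) /\ of_class_C n' (partial2 f)
  else True.

(* Elements of C^oo_c(A), A open, extended by zero to the whole plane. *)
Definition test_function (A : set (R * R)) (phi : R * R -> R) : Prop :=
  let supp := closure [set x | phi x != 0] in
  [/\ forall n, of_class_C n phi, compact supp & supp `<=` A].

Definition dist_partial1 (f phi : R * R -> R) : R :=
  - \int[lebesgue2]_(x in square) (f x * partial1 phi x).

Definition dist_partial2 (f phi : R * R -> R) : R :=
  - \int[lebesgue2]_(x in square) (f x * partial2 phi x).

Definition dist_div (s : R * R -> R * R) (phi : R * R -> R) : R :=
  - \int[lebesgue2]_(x in square)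
      ((s x).1 * partial1 phi x + (s x).2 * partial2 phi x).

Definition dot n (a b : 'rV[R]_n) : R := \sum_i a 0 i * b 0 i.
(* The library norm on matrices is the sup norm. *)
Definition norm2 n (a : 'rV[R]_n) : R := Num.sqrt (dot a a).

Section Normal.
Variable u : R * R -> R.

(* On the null set where u is not differentiable the values of [partial1 u] and
   [partial2 u] are irrelevant: these functions only occur under integrals. *)
Definition area_density (x : R * R) : R :=
  1 + (partial1 u x ^+ 2 + partial2 u x ^+ 2).

Definition unit_normal (x : R * R) : 'rV[R]_3 :=
  (Num.sqrt (area_density x))^-1 *:
    \row_(j < 3) [:: - partial1 u x; - partial2 u x; 1]`_j.

Definition sigma (j : 'I_3) (x : R * R) : R * R :=
  (- (unit_normal x 0 j * partial2 u x), unit_normal x 0 j * partial1 u x).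

(* The k-th component of m_u^j = (D nu_u^j, Div sigma_u^j). *)
Definition curvature_dist (j k : 'I_3) (phi : R * R -> R) : R :=
  [:: dist_partial1 (fun x => unit_normal x 0 j) phi;
      dist_partial2 (fun x => unit_normal x 0 j) phi;
      dist_div (sigma j) phi]`_k.

End Normal.

End Plane.

Section Charges.
Context {d : measure_display} {T : measurableType d} {R : realType}.

Definition charge_integral (m : {charge set T -> \bar R}) (A : set T)
    (f : T -> R) : R :=
  let cP := cid (Hahn_decomposition m) in
  let cN := cid (projT2 cP) in
  \int[jordan_pos (projT2 cN)]_(x in A) f x
  - \int[jordan_neg (projT2 cN)]_(x in A) f x.

(* A vector-valued measure is a matrix of finite signed measures; its values are
   measured in the Euclidean (Frobenius) norm. *)
Definition charge_norm p q (m : 'I_p -> 'I_q -> {charge set T -> \bar R})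
    (A : set T) : R :=
  Num.sqrt (\sum_j \sum_k fine (m j k A) ^+ 2).

Definition vector_total_variation p q (m : 'I_p -> 'I_q -> {charge set T -> \bar R})
    (A : set T) : \bar R :=
  ereal_sup [set (\sum_(0 <= i <oo) (charge_norm m (F i))%:E)%E | F in
    [set F : (set T)^nat | [/\ forall i, measurable (F i), trivIset setT F &
                              \bigcup_i F i = A]]].

End Charges.

Section Triangulations.
Context {R : realType} {V : finType}.
Implicit Types (p : V -> R * R) (D : {set {set V}}) (u : R * R -> R).

Definition hull p (A : {set V}) : set (R * R) :=
  [set x | exists t : V -> R,
    [/\ forall v, 0 <= t v, forall v, v \notin A -> t v = 0,
        \sum_v t v = 1 & x = \sum_v t v *: p v]].

Definition affinely_independent p (A : {set V}) : Prop :=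
  forall t : V -> R, (forall v, v \notin A -> t v = 0) ->
    \sum_v t v = 0 -> \sum_v t v *: p v = 0 -> forall v, t v = 0.

(* V labels the vertices, p gives their positions, and D is the set of triangles,
   each one given by its three vertices. *)
Definition triangulation p D (A : set (R * R)) : Prop :=
  [/\ forall f, f \in D -> #|f| = 3%N /\ affinely_independent p f,
      forall f g, f \in D -> g \in D ->
        hull p f `&` hull p g = hull p (f :&: g)
    & \bigcup_(f in [set` D]) hull p f = A].

Definition affine_on u (A : set (R * R)) : Prop :=
  exists a b c : R, forall x, A x -> u x = a * x.1 + b * x.2 + c.

Definition edges D : {set {set V}} :=
  [set e : {set V} | (#|e| == 2%N) && [exists f in D, e \subset f]].

Definition one_skeleton p D : set (R * R) :=
  \bigcup_(e in [set` edges D]) hull p e.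

Section Polyhedron.
Variables (p : V -> R * R) (D : {set {set V}}) (u : R * R -> R).

Definition graph_vertex (v : V) : 'rV[R]_3 :=
  \row_(j < 3) [:: (p v).1; (p v).2; u (p v)]`_j.

Definition is_upward_normal (f : {set V}) (n : 'rV[R]_3) : Prop :=
  [/\ norm2 n = 1,
      forall v w, v \in f -> w \in f ->
        dot n (graph_vertex v - graph_vertex w) = 0
    & 0 < n 0 (inord 2)].

(* There is exactly one such vector when f is a nondegenerate triangle. *)
Definition face_normal (f : {set V}) : 'rV[R]_3 :=
  get [set n | is_upward_normal f n].

Definition faces_at (e : {set V}) : {set {set V}} := [set f in D | e \subset f].

Definition edge_length (e : {set V}) : R :=
  if enum e is [:: v; w] then norm2 (graph_vertex v - graph_vertex w) else 0.

Definition dihedral_angle (e : {set V}) : R :=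
  if enum (faces_at e) is [:: f; g] then
    acos (dot (face_normal f) (face_normal g)) else 0.

Definition mean_curvature_energy : R :=
  \sum_(e in edges D | #|faces_at e| == 2%N)
    edge_length e * (2 * sin (dihedral_angle e / 2)).

End Polyhedron.
End Triangulations.

(* Main.v *)
From HB Require Import structures.
Require Import Defs.
From mathcomp Require Import all_boot all_order all_algebra.
From mathcomp Require Import all_classical all_reals all_analysis.
From mathcomp Require Import measurable_realfun ring lra.

(** On each triangle the normal is constant, so by the divergence theorem every
    component of [m_u] is a sum over the edges [e] of a constant times the arc
    measure of [e]. The divergence theorem for a triangle is read off horizontal
    slices: the indicator of the triangle is the winding number of its boundary,
    i.e. a signed count of the edges to the right of a point, and each edge
    contributes the value of the test function at its intersection with the slice.
    Since [u] is continuous, its tangential derivative [tau] along [e] is the same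
    on both sides, and the density on [e] has norm
    [|nu_f - nu_g| * sqrt (1 + tau ^ 2)], where [|nu_f - nu_g| = 2 sin (theta / 2)]
    and the square root turns the length of [e] into that of the edge of the graph.
    Distinct edges meet in at most one point, so the total variation is the sum of
    the variations on the edges. Two faces sharing an edge lie on opposite sides of
    it; hence an edge has at most two faces, its relative interior lies in the open
    square when there are two, and in the boundary of the square when there is
    one. *)

Set Implicit Arguments.
Unset Strict Implicit.
Unset Printing Implicit Defensive.

Import Order.TTheory GRing.Theory Num.Theory numFieldNormedType.Exports.
Local Open Scope classical_set_scope.
Local Open Scope ring_scope.

(** * Null sets and measurability in the plane *)

(** Three features of the definitions shape the argument. Where [u] is not differentiable,
    [partial1 u] and [partial2 u] have unspecified values, so the integrands of the distribution are
    known only off a null set and not known to be measurable; integrals are therefore compared off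
    null sets without assuming measurability. The integral against a charge goes through a chosen
    Hahn decomposition, so it is first shown to be the same for every splitting into two finite
    measures. Triangles and edges carry no orientation: signs enter through products of two [cross]
    terms or through [Num.sg], and reversing an edge always flips two factors at once. The winding
    number spares every case distinction on the shape of a triangle, since each edge contributes
    independently of the others. The divergence part fits the same scheme because [sigma j] is the
    j-th component of the normal times the gradient of [u] after a quarter turn: its flux through an
    edge involves only the derivative of [u] along that edge. Hence all nine densities on an edge
    form a rank-one matrix, whose Euclidean norm is a product. *)

Section NullSets.
Local Open Scope ereal_scope.
Context d (T : measurableType d) (R : realType) (mu : {measure set T -> \bar R}).
Variable N : set T.
Hypotheses (mN : measurable N) (N0 : mu N = 0).
Import HBNNSimple.

(** The integral is a supremum over simple functions below [f]. Setting such a function to 0 on [N]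
    keeps its integral and puts it below [g]; only the simple functions have to be measurable. *)
Lemma le_integral_off_null (f g : T -> \bar R) :
  (forall x, 0 <= f x) -> (forall x, 0 <= g x) ->
  (forall x, ~ N x -> f x = g x) ->
  \int[mu]_x f x <= \int[mu]_x g x.
Proof.
move=> f0 g0 fg; rewrite !ge0_integralTE//.
apply: ge_ereal_sup => _ /= [h hf <-].
have mC : measurable (~` N) by exact: measurableC.
have hE x : (proj_nnsfun h mC x = (h \_ (~` N)) x)%R by rewrite mrestrict.
apply: ereal_sup_ubound; exists (proj_nnsfun h mC).
  move=> x; rewrite hE patchE; case: ifPn => [|_]; last exact: g0.
  by rewrite inE => Nx; rewrite -fg//.
rewrite -!integralT_nnsfun; apply: ae_eq_integral => //; 
  try exact/measurable_EFinP.
exists N; split => // x; apply: contra_notP => Nx _.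
by rewrite hE patchE mem_set.
Qed.

(* No measurability is required of [f] and [g] on the null set. *)
Lemma eq_integral_off_null (D : set T) (f g : T -> \bar R) :
  (forall x, D x -> ~ N x -> f x = g x) ->
  \int[mu]_(x in D) f x = \int[mu]_(x in D) g x.
Proof.
move=> fg; rewrite integral_mkcond [RHS]integral_mkcond.
have h x : ~ N x -> (f \_ D) x = (g \_ D) x.
  by move=> Nx; rewrite !patchE; case: ifPn => //; rewrite inE => Dx; exact: fg.
rewrite integralE [RHS]integralE.
by congr (_ - _); apply/eqP; rewrite eq_le; apply/andP; split;
  apply: le_integral_off_null => // x /h e;
    rewrite ?funeposE ?funenegE e.
Qed.

End NullSets.

Section ProductTopology.
Context {R : realType}.
Notation mR := (measurableTypeR R).

(** The measurable structure is the product one, so [A] is written as a countable union of squares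
    with rational centre and radius. A radius below [e / 2] keeps a square that contains [(x, y)]
    inside the ball of radius [e]. *)
Lemma open_measurable_plane (A : set (R * R)) :
  open A -> measurable (A : set (mR * mR)).
Proof.
move=> oA.
pose Q (i : rat * rat * rat) : set (mR * mR) :=
  (ball (ratr i.1.1 : R) (ratr i.2 : R) : set mR) `*`
  (ball (ratr i.1.2 : R) (ratr i.2 : R) : set mR).
have -> : A = \bigcup_i (if `[< Q i `<=` A >] then Q i else set0).
  apply/seteqP; split => [[x y] Axy|z [i _]]; last first.
    by case: asboolP => // + Qz; exact.
  have /nbhs_ballP[e /= e0 He] : nbhs (x, y) A by exact: open_nbhs_nbhs.
  have e20 : 0 < e / 2 by rewrite divr_gt0.
  have [r] := rat_in_itvoo e20; rewrite in_itv/= => /andP[r0 re].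
  have rat_near (w : R) : exists q : rat, `|ratr q - w| < ratr r.
    have ww : w - ratr r < w + ratr r by lra.
    have [q] := rat_in_itvoo ww; rewrite in_itv/= => /andP[q1 q2].
    by exists q; rewrite ltr_norml; apply/andP; split; lra.
  have [a ax] := rat_near x; have [b yb] := rat_near y.
  exists (a, b, r) => //; case: asboolP => [_|[]] /=; first by split.
  move=> [z1 z2] [/= h1 h2]; apply: He; split => /=; rewrite /ball/= in h1 h2 *.
    rewrite -(subrKA (ratr a)) (le_lt_trans (ler_normD _ _))// (distrC x).
    by move: h1 ax; lra.
  rewrite -(subrKA (ratr b)) (le_lt_trans (ler_normD _ _))// (distrC y).
  by move: h2 yb; lra.
apply: countable_bigcupT_measurable => // i; case: asboolP => // _.
by apply: measurableX; exact: measurable_realfun.measurable_ball.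
Qed.

Lemma continuous_measurable_plane (f : R * R -> R) :
  continuous f -> measurable_fun setT (f : mR * mR -> mR).
Proof.
move=> /continuousP cf.
apply: (measurability _ (measurable_realfun.RGenOpens.measurableE R)).
move=> _ [_ [a [b ->] <-]]; rewrite setTI; apply: open_measurable_plane.
exact/cf/interval_open.
Qed.

End ProductTopology.

(** * The winding number of a triangle *)

Section PlaneGeometry.
Context {R : realType}.
Implicit Types (a b c z : R * R).

(** Twice the signed area of the triangle; positive when [c] lies to the left of the directed line
    from [a] to [b]. *)
Definition cross a b c : R :=
  (b.1 - a.1) * (c.2 - a.2) - (b.2 - a.2) * (c.1 - a.1).

Definition seg a b (t : R) : R * R :=
  (a.1 + t * (b.1 - a.1), a.2 + t * (b.2 - a.2)).

Lemma crossC a b c : cross b a c = - cross a b c.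
Proof. by rewrite /cross; ring. Qed.

Lemma cross_rot a b c : cross b c a = cross a b c.
Proof. by rewrite /cross; ring. Qed.

Lemma cross_sum a b c z : cross a b z + cross b c z + cross c a z = cross a b c.
Proof. by rewrite /cross; ring. Qed.

Lemma crossaa a b : cross a a b = 0.
Proof. by rewrite /cross; ring. Qed.

Lemma cross_swap a b c :
  cross (a.2, a.1) (b.2, b.1) (c.2, c.1) = - cross a b c.
Proof. by rewrite /cross/=; ring. Qed.

Lemma segC a b t : seg b a t = seg a b (1 - t).
Proof. by rewrite /seg; congr pair; ring. Qed.

(** The factor [cross a b c] makes the conditions independent of the orientation; a degenerate
    triangle gives the empty set. *)
Definition open_triangle a b c : set (R * R) :=
  [set z | [/\ 0 < cross a b z * cross a b c, 0 < cross b c z * cross a b c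
             & 0 < cross c a z * cross a b c]].

Lemma cross_continuous a b : continuous (cross a b).
Proof.
move=> z; apply: cvgB; apply: cvgM; try exact: cvg_cst.
- by apply: cvgB; [exact: cvg_snd|exact: cvg_cst].
- by apply: cvgB; [exact: cvg_fst|exact: cvg_cst].
Qed.

Lemma open_open_triangle a b c : open (open_triangle a b c).
Proof.
have o u v : open [set z | 0 < cross u v z * cross a b c].
  rewrite (_ : [set _ | _] =
    (fun z => cross u v z * cross a b c) @^-1` [set x | 0 < x])//.
  apply: open_comp; last exact: open_gt.
  move=> z _; apply: cvgM; [exact: cross_continuous|exact: cvg_cst].
rewrite (_ : open_triangle a b c = [set z | 0 < cross a b z * cross a b c] `&`
  ([set z | 0 < cross b c z * cross a b c] `&`
   [set z | 0 < cross c a z * cross a b c])).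
  by apply: openI; [|apply: openI].
by apply/seteqP; split => [z []|z [? []]].
Qed.

Lemma measurable_line a b :
  measurable ([set z | cross a b z = 0] : set (measurableTypeR R * measurableTypeR R)).
Proof.
rewrite (_ : [set z | _] = ~` [set z | cross a b z != 0]); last first.
  apply/seteqP; split => z /=; first by move=> ->; rewrite eqxx.
  by move/negP; rewrite negbK => /eqP.
apply: measurableC; apply: open_measurable_plane.
rewrite (_ : [set z | _] = cross a b @^-1` [set x | x != 0])//.
apply: open_comp; first by move=> z _; exact: cross_continuous.
exact: open_neq.
Qed.

(** Except at the single abscissa [a.1], a vertical slice of the line has at most one point, and
    none if the line is itself vertical. *)
Lemma line_null a b : a != b -> lebesgue2 [set z | cross a b z = 0] = 0%E.
Proof.
move=> ab; rewrite /lebesgue2/= /product_measure1/=.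
rewrite -(@integral0 _ _ _ (@lebesgue_measure R) setT).
have m1 : measurable [set a.1 : measurableTypeR R] by exact: measurable_set1.
apply: (eq_integral_off_null m1); first exact: lebesgue_measure_set1.
move=> x _ xa /=.
have [b1|b1] := eqVneq b.1 a.1.
  rewrite (_ : xsection _ _ = set0) ?measure0//; apply/seteqP; split => // y.
  rewrite /xsection/= inE /= /cross/= b1 subrr mul0r add0r => /eqP.
  rewrite oppr_eq0 mulf_eq0 !subr_eq0 => /orP[/eqP b2|/eqP//].
  by move: ab; case: (a) (b) b1 b2 => [a1 a2] [? ?] /= -> ->; rewrite eqxx.
apply: (@subset_measure0 _ _ _ lebesgue_measure _
  ([set a.2 + (b.2 - a.2) * (x - a.1) / (b.1 - a.1)] :
    set (measurableTypeR R))) => //.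
- by apply: measurable_xsection; exact: measurable_line.
- move=> y; rewrite /xsection/= inE /= /cross/=.
  move=> e; rewrite -subr_eq0 in b1.
  apply: (mulfI b1).
  have -> : (b.1 - a.1) * (a.2 + (b.2 - a.2) * (x - a.1) / (b.1 - a.1)) =
   (b.1 - a.1) * a.2 + (b.2 - a.2) * (x - a.1) by field.
  by move: e; lra.
- exact: lebesgue_measure_set1.
Qed.

(* The signed crossing of an edge with the ray issued from a point in the
   direction (1, 0): [al] and [be] are the heights of the end points of the edge
   relative to the point, [c] tells on which side of the edge the point lies. *)
Definition edge_turn (al be c : R) : R :=
  ((al < 0)%R%:R - (be < 0)%R%:R) * (if al < 0 then 0 < c else c < 0)%R%:R.

(** The relation is the barycentric identity: the heights of the vertices, weighted by the areas of
    the opposite subtriangles, have mean 0. Each pattern of signs either satisfies the equation by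
    computation or contradicts this relation. *)
Lemma winding (al be ga c1 c2 c3 : R) :
  al != 0 -> be != 0 -> ga != 0 -> c1 != 0 -> c2 != 0 -> c3 != 0 ->
  c2 * al + c3 * be + c1 * ga = 0 ->
  [&& 0 < c1, 0 < c2 & 0 < c3]%R%:R - [&& c1 < 0, c2 < 0 & c3 < 0]%R%:R =
  edge_turn al be c1 + edge_turn be ga c2 + edge_turn ga al c3.
Proof.
rewrite /edge_turn.
case: (ltgtP al 0) => // hal _; case: (ltgtP be 0) => // hbe _;
case: (ltgtP ga 0) => // hga _; case: (ltgtP c1 0) => // h1 _;
case: (ltgtP c2 0) => // h2 _; case: (ltgtP c3 0) => // h3 _ /= e;
  try (by rewrite /=; ring); exfalso; move: e.
all: nra.
Qed.

End PlaneGeometry.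

(** * The divergence theorem on a triangle *)

Section Slices.
Context {R : realType}.
Implicit Types (a b c z : R * R).
Notation mu := (@lebesgue_measure R).

(** The three subareas add up to [cross a b c], so they cannot all have the opposite sign; one of
    the two indicators in [winding] thus vanishes and [Num.sg] restores the sign of the other. *)
Lemma open_triangle_indic a b c z : cross a b c != 0 ->
  a.2 != z.2 -> b.2 != z.2 -> c.2 != z.2 ->
  cross a b z != 0 -> cross b c z != 0 -> cross c a z != 0 ->
  \1_(open_triangle a b c) z = Num.sg (cross a b c) *
   (edge_turn (a.2 - z.2) (b.2 - z.2) (cross a b z) +
    edge_turn (b.2 - z.2) (c.2 - z.2) (cross b c z) +
    edge_turn (c.2 - z.2) (a.2 - z.2) (cross c a z)).
Proof.
rewrite -(subr_eq0 a.2) -(subr_eq0 b.2) -(subr_eq0 c.2) => d0 ay byy cy n1 n2 n3.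
rewrite -winding//; last by rewrite /cross; ring.
have := cross_sum a b c z; rewrite indicE.
have -> : (z \in open_triangle a b c) = [&& 0 < cross a b z * cross a b c,
   0 < cross b c z * cross a b c & 0 < cross c a z * cross a b c].
  by apply/idP/idP; rewrite inE => /and3P.
case: (sgrP (cross a b c)) d0 => // d0 _ e.
  rewrite !pmulr_lgt0// mul1r.
  suff -> : [&& cross a b z < 0, cross b c z < 0 & cross c a z < 0] = false by rewrite subr0.
  by apply/negP => /and3P[]; lra.
rewrite !nmulr_lgt0// mulN1r.
suff -> : [&& 0 < cross a b z, 0 < cross b c z & 0 < cross c a z] = false.
  by rewrite sub0r opprK.
by apply/negP => /and3P[]; lra.
Qed.

(* Junk when the edge is horizontal; such an edge has no [edge_turn]. *)
Definition abscissa a b (y : R) : R :=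
  a.1 + (y - a.2) / (b.2 - a.2) * (b.1 - a.1).

Lemma cross_abscissa a b x y : b.2 != a.2 ->
  cross a b (x, y) = (b.2 - a.2) * (abscissa a b y - x).
Proof. by rewrite -subr_eq0 => ab; rewrite /cross /abscissa/=; field. Qed.

(** On a slice the sign of [cross] is that of [b.2 - a.2] times that of [abscissa a b y - x]; the
    case distinction in [edge_turn] absorbs the first factor. *)
Lemma edge_turn_slice a b x y : a.2 != y -> b.2 != y ->
  edge_turn (a.2 - y) (b.2 - y) (cross a b (x, y)) =
  ((a.2 < y)%R%:R - (b.2 < y)%R%:R) * (x < abscissa a b y)%R%:R.
Proof.
move=> ay by_; rewrite /edge_turn !(subr_lt0 y).
case: (ltgtP a.2 y) ay => // ay _; case: (ltgtP b.2 y) by_ => // by_ _;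
  rewrite ?subrr ?mul0r//.
all: rewrite cross_abscissa; last by rewrite -subr_eq0; apply/eqP; lra.
  by rewrite pmulr_rgt0 ?subr_gt0//; lra.
by rewrite nmulr_rlt0 ?subr_gt0// ?subr_lt0; lra.
Qed.

(** A nonzero difference of indicators puts [y] between the heights of the end points, so the
    abscissa is a convex combination of [a.1] and [b.1]. *)
Lemma abscissa_itv a b y : 0 <= a.1 <= 1 -> 0 <= b.1 <= 1 ->
  (a.2 < y)%R%:R - (b.2 < y)%R%:R != 0 :> R -> a.2 != y -> b.2 != y ->
  0 <= abscissa a b y <= 1.
Proof.
move=> a01 b01 e ay by_.
have ba0 : b.2 - a.2 != 0.
  by apply: contra_neq e => /subr0_eq ->; rewrite subrr.
have h : 0 <= (y - a.2) / (b.2 - a.2) <= 1.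
  case: (ltgtP a.2 y) ay e => // ay _; case: (ltgtP b.2 y) by_ => // by_ _;
    rewrite ?subrr ?eqxx// => _.
    have h : 0 < b.2 - a.2 by lra.
    by rewrite divr_ge0 ?ler_pdivrMr//; lra.
  rewrite -mulrNN -invrN; have h : 0 < - (b.2 - a.2) by lra.
  by rewrite divr_ge0 ?ler_pdivrMr//; lra.
by rewrite /abscissa; move: ((y - a.2) / _) h => t /andP[t0 t1]; apply/andP; split; nra.
Qed.

Lemma continuous_integrable01 (g : R -> R) : continuous g ->
  mu.-integrable `[0, 1] (EFin \o g).
Proof.
move=> cg; apply: continuous_compact_integrable; first exact: segment_compact.
exact: continuous_subspaceT.
Qed.

Lemma integrable01_lt (g : R -> R) X : continuous g ->
  mu.-integrable `[0, 1] (EFin \o (fun x => (x < X)%R%:R * g x)).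
Proof.
move=> cg.
rewrite (_ : (EFin \o _) = (EFin \o (g \_ `]-oo, X[))); last first.
  apply/funext => x /=; rewrite patchE mem_setE in_itv/=.
  by case: ifP; rewrite ?mul1r ?mul0r.
rewrite -restrict_EFin; apply/integrable_restrict => //.
apply: integrableS (continuous_integrable01 cg) => //.
exact: measurableI.
Qed.

Lemma Rintegral01_lt (G g : R -> R) X : 0 <= X <= 1 -> continuous g ->
  (forall x : R, is_derive x 1 G (g x)) ->
  \int[mu]_(x in `[0, 1]) ((x < X)%R%:R * g x) = G X - G 0.
Proof.
move=> /andP[X0 X1] cg dG.
have cG : continuous G.
  move=> x; apply: differentiable_continuous; apply/derivable1_diffP.
  by case: (dG x).
transitivity (\int[mu]_(x in `[0, 1] `&` `]-oo, X[) g x).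
  rewrite Rintegral_mkcondr; apply: eq_Rintegral => x _.
  by rewrite patchE mem_setE in_itv/=; case: ifP; rewrite ?mul1r ?mul0r.
rewrite (_ : _ `&` _ = `[0, X[)%classic; last first.
  by apply/seteqP; split => x /=; rewrite !in_itv/= => h; apply/andP; lra.
have cgw A : {within A, continuous g} by exact: continuous_subspaceT.
rewrite Rintegral_itv_bndo_bndc; last first.
  apply: integrableS (continuous_integrable01 cg) => //.
  by move=> x /=; rewrite !in_itv/=; lra.
(* The fundamental theorem is applied on a nondegenerate interval, so [X = 0] is treated apart. *)
move: X0; rewrite le_eqVlt => /orP[/eqP <-|X0].
  by rewrite set_itv1 Rintegral_set1 subrr.
rewrite /Rintegral (@continuous_FTC2 _ g G)//.
  split => [x _||].
  - by have := dG x; case.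
  - exact/cvg_at_right_filter/cG.
  - exact/cvg_at_left_filter/cG.
by move=> x _; rewrite derive1E; have := dG x; case.
Qed.

End Slices.

Section Green.
Context {R : realType}.
Implicit Types (a b c z : R * R) (phi : R * R -> R).
Notation mu := (@lebesgue_measure R).

Lemma is_derive_affine (p q t : R) : is_derive t 1 (fun t => p + t * q) q.
Proof.
have := is_deriveD (is_derive_cst p t 1)
  (is_deriveM (is_derive_id t 1) (is_derive_cst q t 1)).
by rewrite scaler0 !add0r /GRing.scale/= mulr1.
Qed.

Lemma continuous_pair (T : topologicalType) (f g : T -> R) : continuous f -> continuous g ->
  continuous (fun t => (f t, g t)).
Proof. by move=> cf cg t; exact: (cvg_pair (cf t) (cg t)). Qed.

Lemma continuous_affine (p q : R) : continuous (fun t : R => p + t * q).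
Proof.
move=> t; apply: differentiable_continuous; apply/derivable1_diffP.
by case: (is_derive_affine p q t).
Qed.

Definition line_integral phi a b : R := \int[mu]_(t in `[0, 1]) phi (seg a b t).

Lemma seg_continuous a b : continuous (seg a b).
Proof. by apply: continuous_pair; exact: continuous_affine. Qed.

(** Substitute [1 - t] for [t]. The line integral is thus unoriented, and orientation survives only
    in the coordinate differences that multiply it. *)
Lemma line_integralC phi a b : continuous phi ->
  line_integral phi b a = line_integral phi a b.
Proof.
move=> cphi; rewrite /line_integral /Rintegral; congr fine.
rewrite [RHS](@integration_by_substitution_onem R (fun t => phi (seg a b t)) 1) ?lexx ?ler01//.
  by rewrite mathcomp.classical.unstable.onem1; apply: eq_integral => t _; rewrite segC.
apply: continuous_subspaceT => t.
by apply: continuous_comp; [exact: seg_continuous|exact: cphi].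
Qed.

Lemma chord_continuous phi a b : continuous phi ->
  continuous (fun y => phi (abscissa a b y, y)).
Proof.
move=> cphi y.
apply: (@continuous_comp _ _ _ (fun y => (abscissa a b y, y)) phi); last exact: cphi.
apply: continuous_pair => w; last exact: cvg_id.
apply: cvgD; first exact: cvg_cst.
apply: cvgM; last exact: cvg_cst.
apply: cvgM; last exact: cvg_cst.
by apply: cvgB; [exact: cvg_id|exact: cvg_cst].
Qed.

Lemma Rintegral_chord phi a b : continuous phi -> a.2 < b.2 ->
  \int[mu]_(y in `[a.2, b.2]) phi (abscissa a b y, y) =
  (b.2 - a.2) * line_integral phi a b.
Proof.
move=> cphi ab; pose F t : R := a.2 + t * (b.2 - a.2).
have F0 : F 0 = a.2 by rewrite /F; ring.
have F1 : F 1 = b.2 by rewrite /F; ring.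
have ba : 0 < b.2 - a.2 by rewrite subr_gt0.
have dF (t : R) : is_derive t 1 F (b.2 - a.2).
  exact: is_derive_affine.
have F'E : derive1 F = cst (b.2 - a.2).
  by apply/funext => t; rewrite derive1E derive_val.
have cF : continuous F by exact: continuous_affine.
have cseg : continuous (fun t => phi (seg a b t)).
  by move=> t; apply: continuous_comp; [exact: seg_continuous|exact: cphi].
rewrite /line_integral -RintegralZl//; last exact: continuous_integrable01.
rewrite -[in LHS]F0 -[in LHS]F1 /Rintegral; congr fine.
rewrite [LHS](@integration_by_substitution_increasing R F
  (fun y => phi (abscissa a b y, y)) 0 1)//.
- apply: eq_integral => t _ /=; rewrite F'E /= mulrC; congr (_ * phi _)%:E.
  rewrite /abscissa /seg /F; congr pair.
  by have := lt0r_neq0 ba => ba0; field.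
- by move=> x y _ _ xy; rewrite /F ltrD2l ltr_pM2r.
- by move=> x _; rewrite F'E; exact: cvg_cst.
- by rewrite F'E; exact: is_cvg_cst.
- by rewrite F'E; exact: is_cvg_cst.
- split.
  + by move=> x _; case: (dF x).
  + exact/cvg_at_right_filter/cF.
  + exact/cvg_at_left_filter/cF.
- by apply: continuous_subspaceT; exact: chord_continuous.
Qed.

(** The boundary term left by the fundamental theorem where the edge crosses the slice at height
    [y]: with sign +1 for a rising edge, -1 for a falling one, and 0 without a crossing. *)
Definition chord_term phi a b (y : R) : R :=
  ((a.2 < y)%R%:R - (b.2 < y)%R%:R) * phi (abscissa a b y, y).

(** Only a rising edge is computed. A falling edge is a rising one read backwards, which negates
    both sides, and a horizontal edge gives 0 on both sides. *)
Lemma Rintegral_chord_term phi a b : continuous phi ->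
  0 <= a.2 <= 1 -> 0 <= b.2 <= 1 ->
  mu.-integrable `[0, 1] (EFin \o chord_term phi a b) /\
  \int[mu]_(y in `[0, 1]) chord_term phi a b y =
  (b.2 - a.2) * line_integral phi a b.
Proof.
move=> cphi.
have main a' b' : 0 <= a'.2 <= 1 -> 0 <= b'.2 <= 1 -> a'.2 < b'.2 ->
  mu.-integrable `[0, 1] (EFin \o chord_term phi a' b') /\
  \int[mu]_(y in `[0, 1]) chord_term phi a' b' y =
  (b'.2 - a'.2) * line_integral phi a' b'.
  move=> /andP[a0 a1] /andP[b0 b1] ab.
  have E : chord_term phi a' b' = (fun y => phi (abscissa a' b' y, y)) \_ `]a'.2, b'.2].
    apply/funext => y; rewrite /chord_term patchE mem_setE in_itv/=.
    by case: (ltP a'.2 y); case: (ltP b'.2 y) => h1 h2 /=;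
      rewrite ?subrr ?mul0r// ?subr0 ?mul1r//; lra.
  have I : `[0, 1] `&` `]a'.2, b'.2] = `]a'.2, b'.2]%classic.
    apply/seteqP; split => [y []//|y /=]; rewrite !in_itv/=; lra.
  have i := continuous_integrable01 (@chord_continuous phi a' b' cphi).
  split.
    rewrite E -restrict_EFin; apply/integrable_restrict => //.
    apply: integrableS i => //; exact: measurableI.
  rewrite -Rintegral_chord// E -Rintegral_mkcondr I Rintegral_itv_obnd_cbnd//.
  apply: integrableS i => // y /=; rewrite !in_itv/=; lra.
move=> a01 b01; have [ab|ba|ab] := ltgtP a.2 b.2; first exact: main.
  have [i e] := main _ _ b01 a01 ba.
  have E : chord_term phi a b = (fun y => - chord_term phi b a y).
    apply/funext => y; rewrite /chord_term -mulNr opprB; congr (_ * phi (_, _)).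
    rewrite /abscissa; have h : b.2 - a.2 != 0 by rewrite subr_eq0; apply/negP => /eqP; lra.
    have h' : a.2 - b.2 != 0 by rewrite subr_eq0; apply/negP => /eqP; lra.
    by field; rewrite h h'.
  rewrite E; split.
    have := integrableN i => //; apply: eq_integrable => //.
  have -> : \int[mu]_(y in `[0, 1]) (- chord_term phi b a y) =
    \int[mu]_(y in `[0, 1]) (-1 * chord_term phi b a y).
    by apply: eq_Rintegral => y _; rewrite mulN1r.
  by rewrite RintegralZl// e line_integralC//; ring.
have -> : chord_term phi a b = cst 0.
  by apply/funext => y; rewrite /chord_term ab subrr mul0r.
split; first exact: integrable0.
by rewrite Rintegral_cst// ab subrr !mul0r.
Qed.

End Green.

Section RealIntegrable.
Context d (T : measurableType d) (R : realType) (mu : {measure set T -> \bar R}).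
Variables (A : set T) (mA : measurable A).
Implicit Types f g : T -> R.

Lemma integrable_mulrl (k : R) f : mu.-integrable A (EFin \o f) ->
  mu.-integrable A (EFin \o (fun x => k * f x)).
Proof.
by move=> i; have := integrableZl mA k i; apply: eq_integrable => // x _; rewrite /= EFinM.
Qed.

Lemma integrable_addr f g : mu.-integrable A (EFin \o f) ->
  mu.-integrable A (EFin \o g) -> mu.-integrable A (EFin \o (fun x => f x + g x)).
Proof.
by move=> i j; have := integrableD mA i j; apply: eq_integrable => // x _; rewrite /= EFinD.
Qed.

End RealIntegrable.

Section GreenTriangle.
Context {R : realType}.
Implicit Types (a b c z : R * R) (phi psi : R * R -> R).
Notation mu := (@lebesgue_measure R).

Lemma set3_null (x y z : R) : mu [set x; y; z] = 0%E.
Proof.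
by apply: countable_lebesgue_measure0; exact/finite_set_countable/finite_set3.
Qed.

(** The factor stays on both sides because the abscissa is known to lie in [0, 1] only when the
    slice meets the edge. *)
Lemma edge_turn_term a b y (G g : R -> R) :
  a.2 != y -> b.2 != y -> 0 <= a.1 <= 1 -> 0 <= b.1 <= 1 ->
  continuous g -> (forall x : R, is_derive x 1 G (g x)) -> G 0 = 0 ->
  ((a.2 < y)%R%:R - (b.2 < y)%R%:R) *
    \int[mu]_(x in `[0, 1]) ((x < abscissa a b y)%R%:R * g x) =
  ((a.2 < y)%R%:R - (b.2 < y)%R%:R) * G (abscissa a b y).
Proof.
move=> ay by_ a01 b01 cg dG G0.
have [->|k0] := eqVneq ((a.2 < y)%R%:R - (b.2 < y)%R%:R) (0 : R).
  by rewrite !mul0r.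
by rewrite (Rintegral01_lt (abscissa_itv a01 b01 k0 ay by_) cg dG) G0 subr0.
Qed.

Lemma green_slice phi psi a b c y :
  cross a b c != 0 -> a.2 != y -> b.2 != y -> c.2 != y ->
  0 <= a.1 <= 1 -> 0 <= b.1 <= 1 -> 0 <= c.1 <= 1 ->
  continuous psi -> phi (0, y) = 0 ->
  (forall x : R, is_derive x 1 (fun x => phi (x, y)) (psi (x, y))) ->
  \int[mu]_(x in `[0, 1]) (\1_(open_triangle a b c) (x, y) * psi (x, y)) =
  Num.sg (cross a b c) *
   (chord_term phi a b y + chord_term phi b c y + chord_term phi c a y).
Proof.
move=> d0 ay byy cy a01 b01 c01 cpsi phi0 dphi.
pose g x := psi (x, y).
have cg : continuous g.
  move=> x; apply: (@continuous_comp _ _ _ (fun x => (x, y)) psi); last exact: cpsi.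
  by apply: continuous_pair => w; [exact: cvg_id|exact: cvg_cst].
pose k (u v : R * R) : R := Num.sg (cross a b c) * ((u.2 < y)%R%:R - (v.2 < y)%R%:R).
pose X (u v : R * R) := abscissa u v y.
pose h u v x : R := (x < X u v)%R%:R * g x.
pose N : set (measurableTypeR R) := [set X a b; X b c; X c a].
have mN : measurable N by do 2 apply: measurableU => //.
have N0 : mu N = 0%E.
  exact: set3_null.
transitivity (\int[mu]_(x in `[0, 1])
    (k a b * h a b x + k b c * h b c x + k c a * h c a x)).
  rewrite /Rintegral; congr fine.
  apply: (eq_integral_off_null mN N0) => x _ Nx; congr EFin.
  (* This includes horizontal edges, where [X u v] is junk: the slice has another height than such
     an edge and misses its line. *)
  have nz u v : u.2 != y -> v.2 != y -> x != X u v -> u != v -> cross u v (x, y) != 0.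
    move=> uy vy xX uv; have [e|e] := eqVneq v.2 u.2.
      rewrite /cross/= e subrr mul0r subr0 mulf_neq0// subr_eq0 ?(eq_sym y)//.
      by apply: contra_neq uv => e1; apply/esym/eqP; rewrite -pair_eqE/= e e1 !eqxx.
    by rewrite cross_abscissa// mulf_neq0 ?subr_eq0// eq_sym.
  have nX u v : N (X u v) -> x != X u v by move=> ?; apply/eqP => e; apply: Nx; rewrite e.
  have ne : [/\ a != b, b != c & c != a].
    split; apply: contra_neq d0 => ->; rewrite /cross; ring.
  case: ne => n1 n2 n3.
  rewrite open_triangle_indic//=; first last.
  - by apply: nz => //; apply: nX; right.
  - by apply: nz => //; apply: nX; left; right.
  - by apply: nz => //; apply: nX; left; left.
  by rewrite !edge_turn_slice// /k /h /g /X; ring.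
have ih u v : mu.-integrable `[0, 1] (EFin \o h u v) by exact: integrable01_lt.
have ikh u v : mu.-integrable `[0, 1] (EFin \o (fun x => k u v * h u v x)).
  exact: integrable_mulrl.
rewrite RintegralD//; last exact: integrable_addr.
rewrite RintegralD// !RintegralZl// /k -!mulrA -!mulrDr /h /X.
by rewrite !(@edge_turn_term _ _ _ (fun x => phi (x, y))).
Qed.

Lemma green_iterated phi psi a b c :
  cross a b c != 0 -> square a -> square b -> square c ->
  continuous phi -> continuous psi -> (forall y, phi (0, y) = 0) ->
  (forall x y : R, is_derive x 1 (fun x => phi (x, y)) (psi (x, y))) ->
  \int[mu]_(y in `[0, 1]) \int[mu]_(x in `[0, 1])
      (\1_(open_triangle a b c) (x, y) * psi (x, y)) =
  Num.sg (cross a b c) *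
   ((b.2 - a.2) * line_integral phi a b + (c.2 - b.2) * line_integral phi b c
    + (a.2 - c.2) * line_integral phi c a).
Proof.
move=> d0 [/= a1 a2] [/= b1 b2] [/= c1 c2] cphi cpsi phi0 dphi.
rewrite /= !in_itv/= in a1 a2 b1 b2 c1 c2.
pose N : set (measurableTypeR R) := [set a.2; b.2; c.2].
have mN : measurable N by do 2 apply: measurableU => //.
have N0 : mu N = 0%E.
  exact: set3_null.
transitivity (\int[mu]_(y in `[0, 1]) (Num.sg (cross a b c) *
   (chord_term phi a b y + chord_term phi b c y + chord_term phi c a y))).
  rewrite /Rintegral; congr fine.
  apply: (eq_integral_off_null mN N0) => y _ Ny; congr EFin.
  by apply: green_slice => //; apply/eqP => e; apply: Ny; rewrite /N/= e; tauto.
have [i1 <-] := Rintegral_chord_term cphi a2 b2.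
have [i2 <-] := Rintegral_chord_term cphi b2 c2.
have [i3 <-] := Rintegral_chord_term cphi c2 a2.
have i12 : mu.-integrable `[0, 1]
    (EFin \o (fun y => chord_term phi a b y + chord_term phi b c y)).
  exact: integrable_addr.
rewrite RintegralZl//; last exact: integrable_addr.
by rewrite RintegralD// RintegralD.
Qed.

End GreenTriangle.

(** * Fubini's theorem on the unit square *)

Section FubiniSquare.
Context {R : realType}.
Notation mu := (@lebesgue_measure R).
Notation mR := (measurableTypeR R).

Lemma lebesgue2_square : lebesgue2 (square : set (mR * mR)) = 1%E.
Proof.
transitivity (mu `[0%R, 1%R] * mu `[0%R, 1%R])%E; first exact: product_measure1E.
by rewrite lebesgue_measure_itv/= lte_fin ltr01 oppr0 adde0 mule1.
Qed.

Lemma measurable_square : measurable (square : set (mR * mR)).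
Proof. exact: measurableX. Qed.

Variable F : R * R -> R.
Hypothesis mF : measurable_fun setT (F : mR * mR -> mR).
Variable M : R.
Hypothesis bF : forall z, square z -> `|F z| <= M.

Lemma integrable_square : lebesgue2.-integrable square (EFin \o F).
Proof.
apply: measurable_bounded_integrable.
- exact: measurable_square.
- by rewrite lebesgue2_square ltry.
- exact: measurable_funTS.
- exists M; split; first exact: num_real.
  by move=> x Mx z sz; apply: le_trans (ltW Mx); exact: bF.
Qed.

Let lebesgue01_fin : (mu `[0%R, 1%R] < +oo)%E.
Proof. by rewrite lebesgue_measure_itv/= lte_fin ltr01 oppr0 adde0 ltry. Qed.

Let integrable_patch_square :
  (mu \x mu)%E.-integrable setT ((EFin \o F) \_ square).
Proof. exact: (integrable_mkcond _ measurable_square).1 integrable_square. Qed.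

(** Real integrals are [fine] of extended ones, so Fubini transfers only once every inner integral
    is known to be finite; the bound [M] provides this slice by slice. *)
Lemma Rintegral_square21 :
  \int[lebesgue2]_(z in square) F z =
  \int[mu]_(y in `[0, 1]) \int[mu]_(x in `[0, 1]) F (x, y).
Proof.
rewrite /Rintegral; congr fine.
rewrite integral_mkcond.
transitivity (\int[(mu \x mu)%E]_z ((EFin \o F) \_ square) z)%E; first by [].
rewrite -(integral21_prod_meas1 integrable_patch_square).
rewrite [RHS]integral_mkcond; apply: eq_integral => y _.
rewrite /fubini_G patchE; case: ifPn => [|y01].
  rewrite inE => y01; rewrite fineK; last first.
    apply: integrable_fin_num => //; apply: measurable_bounded_integrable => //.
    - by apply: measurable_funTS; exact: (measurable_fun_pair1 y mF).
    - exists M; split; first exact: num_real.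
      by move=> x Mx z z01; apply: le_trans (ltW Mx); exact: bF.
  rewrite [RHS]integral_mkcond; apply: eq_integral => x _.
  rewrite !patchE /square; congr (if _ then _ else _).
  by apply/idP/idP; rewrite !inE; [case|split].
apply: integral0_eq => x _; rewrite patchE ifF//.
by apply: contraNF y01; rewrite !inE => -[].
Qed.

Lemma Rintegral_square12 :
  \int[lebesgue2]_(z in square) F z =
  \int[mu]_(x in `[0, 1]) \int[mu]_(y in `[0, 1]) F (x, y).
Proof.
rewrite /Rintegral; congr fine.
rewrite integral_mkcond.
transitivity (\int[(mu \x mu)%E]_z ((EFin \o F) \_ square) z)%E; first by [].
rewrite -(integral12_prod_meas1 integrable_patch_square).
rewrite [RHS]integral_mkcond; apply: eq_integral => x _.
rewrite /fubini_F patchE; case: ifPn => [|x01].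
  rewrite inE => x01; rewrite fineK; last first.
    apply: integrable_fin_num => //; apply: measurable_bounded_integrable => //.
    - by apply: measurable_funTS; exact: (measurable_fun_pair2 x mF).
    - exists M; split; first exact: num_real.
      by move=> y My z z01; apply: le_trans (ltW My); exact: bF.
  rewrite [RHS]integral_mkcond; apply: eq_integral => y _.
  rewrite !patchE /square; congr (if _ then _ else _).
  by apply/idP/idP; rewrite !inE; [case|split].
apply: integral0_eq => y _; rewrite patchE ifF//.
by apply: contraNF x01; rewrite !inE => -[].
Qed.

End FubiniSquare.

(** * Green's formula for test functions *)

Section TestFunctions.
Context {R : realType}.
Notation mu := (@lebesgue_measure R).
Notation mR := (measurableTypeR R).
Implicit Types (phi psi : R * R -> R) (a b c : R * R).

Lemma is_derive_slice1 phi (x y : R) : derivable phi (x, y) (1, 0) ->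
  is_derive x 1 (fun x => phi (x, y)) (partial1 phi (x, y)).
Proof.
have E : (fun h : R => h^-1 *: (phi (h *: (1, 0) + (x, y)) - phi (x, y))) =
  (fun h : R => h^-1 *: (phi (h *: 1 + x, y) - phi (x, y))).
  apply/funext => h; congr (_ *: (phi _ - _)).
  by congr pair; rewrite /= scaler0 add0r.
rewrite /derivable E => d; apply: DeriveDef; first exact: d.
by rewrite /partial1 /derive E.
Qed.

Lemma is_derive_slice2 phi (x y : R) : derivable phi (x, y) (0, 1) ->
  is_derive y 1 (fun y => phi (x, y)) (partial2 phi (x, y)).
Proof.
have E : (fun h : R => h^-1 *: (phi (h *: (0, 1) + (x, y)) - phi (x, y))) =
  (fun h : R => h^-1 *: (phi (x, h *: 1 + y) - phi (x, y))).
  apply/funext => h; congr (_ *: (phi _ - _)).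
  by congr pair; rewrite /= scaler0 add0r.
rewrite /derivable E => d; apply: DeriveDef; first exact: d.
by rewrite /partial2 /derive E.
Qed.

Lemma compact_square : compact (square : set (R * R)).
Proof. by apply: compact_setX; exact: segment_compact. Qed.

Lemma continuous_bounded_square phi : continuous phi ->
  exists M, forall z, square z -> `|phi z| <= M.
Proof.
move=> cphi.
have : compact (phi @` square).
  apply: continuous_compact; last exact: compact_square.
  exact: continuous_subspaceT.
move=> /compact_bounded[M [_ hM]]; exists (M + 1) => z sz.
by apply: (hM (M + 1)); [rewrite ltrDl|exists z].
Qed.

(** A point with a ball of radius [e] inside the square can be moved by [e / 2] in the four axis
    directions without leaving it. It follows that test functions vanish on the axes, where the
    primitives on slices start. *)
Lemma interior_square : (square : set (R * R))° `<=` `]0, 1[ `*` `]0, 1[.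
Proof.
move=> [x y] /nbhs_ballP[e /= e0 h].
have e2 : 0 < e / 2 by rewrite divr_gt0.
have he z : `|z| <= e / 2 -> `|z| < e.
  by move=> /le_lt_trans; apply; rewrite ltr_pdivrMr// mulr_natr mulr2n ltrDl.
have n1 : `|e / 2| < e by apply: he; rewrite ger0_norm// ltW.
have n0 : `|0 : R| < e by rewrite normr0.
have [] := h (x - e / 2, y).
  by split; rewrite /ball/=; [rewrite opprB addrC subrK|rewrite subrr].
have [] := h (x + e / 2, y).
  by split; rewrite /ball/=; [rewrite opprD addNKr normrN|rewrite subrr].
have [] := h (x, y - e / 2).
  by split; rewrite /ball/=; [rewrite subrr|rewrite opprB addrC subrK].
have [] := h (x, y + e / 2).
  by split; rewrite /ball/=; [rewrite subrr|rewrite opprD addNKr normrN].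
by rewrite /= !in_itv/=; lra.
Qed.

Variable phi : R * R -> R.
Hypothesis tphi : test_function square° phi.

Lemma test_continuous : continuous phi.
Proof. by case: tphi => /(_ 0%N)[]. Qed.

Lemma test_partial1_continuous : continuous (partial1 phi).
Proof. by case: tphi => /(_ 1%N)[_ [_ [[]]]]. Qed.

Lemma test_partial2_continuous : continuous (partial2 phi).
Proof. by case: tphi => /(_ 1%N)[_ [_ [_ []]]]. Qed.

Lemma test_derivable z : derivable phi z (1, 0) /\ derivable phi z (0, 1).
Proof. by case: tphi => /(_ 1%N)[_ [/(_ z)]]. Qed.

Lemma test_eq0 z : ~ square° z -> phi z = 0.
Proof.
case: tphi => _ _ sub nz; apply: contrapT => /eqP pz; apply: nz.
by apply: sub; apply: subset_closure.
Qed.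

Lemma measurable_open_triangle a b c :
  measurable (open_triangle a b c : set (mR * mR)).
Proof. by apply: open_measurable_plane; exact: open_open_triangle. Qed.

Lemma indic_mul_measurable (T : set (mR * mR)) psi : measurable T ->
  continuous psi -> measurable_fun setT ((fun z => \1_T z * psi z) : mR * mR -> mR).
Proof.
move=> mT cpsi; apply: measurable_funM; first exact: measurable_indic.
exact: continuous_measurable_plane.
Qed.

Lemma indic_mul_bounded (T : set (R * R)) psi : continuous psi ->
  exists M, forall z, square z -> `|\1_T z * psi z| <= M.
Proof.
move=> cpsi; have [M hM] := continuous_bounded_square cpsi; exists M => z sz.
rewrite normrM indicE; case: (_ \in _); rewrite ?normr1 ?mul1r ?hM//.
by rewrite normr0 mul0r (le_trans _ (hM z sz)).
Qed.

Lemma indic_mul_integrable (T : set (mR * mR)) psi : measurable T ->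
  continuous psi ->
  lebesgue2.-integrable square (EFin \o (fun z => \1_T z * psi z)).
Proof.
move=> mT cpsi; have [M hM] := indic_mul_bounded T cpsi.
exact: (integrable_square (indic_mul_measurable mT cpsi) hM).
Qed.

Lemma green1 a b c : cross a b c != 0 -> square a -> square b -> square c ->
  \int[lebesgue2]_(z in square) (\1_(open_triangle a b c) z * partial1 phi z) =
  Num.sg (cross a b c) *
   ((b.2 - a.2) * line_integral phi a b + (c.2 - b.2) * line_integral phi b c
    + (a.2 - c.2) * line_integral phi c a).
Proof.
move=> d0 sa sb sc.
have mT := measurable_open_triangle a b c.
have [M hM] := indic_mul_bounded (open_triangle a b c) test_partial1_continuous.
rewrite (Rintegral_square21 (indic_mul_measurable mT test_partial1_continuous) hM).
apply: green_iterated => //.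
- exact: test_continuous.
- exact: test_partial1_continuous.
- by move=> y; apply: test_eq0 => /interior_square[/=]; rewrite in_itv/= ltxx.
- by move=> x y; apply: is_derive_slice1; case: (test_derivable (x, y)).
Qed.

(** Reflection in the diagonal reduces this to [green_iterated]; it reverses the orientation of the
    triangle, whence the minus sign. *)
Lemma green2 a b c : cross a b c != 0 -> square a -> square b -> square c ->
  \int[lebesgue2]_(z in square) (\1_(open_triangle a b c) z * partial2 phi z) =
  - Num.sg (cross a b c) *
   ((b.1 - a.1) * line_integral phi a b + (c.1 - b.1) * line_integral phi b c
    + (a.1 - c.1) * line_integral phi c a).
Proof.
move=> d0 sa sb sc.
have mT := measurable_open_triangle a b c.
have [M hM] := indic_mul_bounded (open_triangle a b c) test_partial2_continuous.
rewrite (Rintegral_square12 (indic_mul_measurable mT test_partial2_continuous) hM).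
pose sw (z : R * R) := (z.2, z.1).
have csw : continuous sw.
  by apply: continuous_pair => z; [exact: cvg_snd|exact: cvg_fst].
have csp psi : continuous psi -> continuous (psi \o sw).
  by move=> cpsi z; apply: continuous_comp; [exact: csw|exact: cpsi].
have T x y : \1_(open_triangle a b c) (x, y) =
    \1_(open_triangle (sw a) (sw b) (sw c)) (y, x) :> R.
  rewrite !indicE; congr (_ %:R); congr (nat_of_bool _); apply/idP/idP; rewrite !inE;
  by rewrite /open_triangle/= !(cross_swap _ _ _) -/(sw (x, y))
    ?(cross_swap _ _ (x, y)) !mulrNN.
transitivity (\int[mu]_(x in `[0, 1]) \int[mu]_(y in `[0, 1])
   (\1_(open_triangle (sw a) (sw b) (sw c)) (y, x) * (partial2 phi \o sw) (y, x))).
  by apply: eq_Rintegral => x _; apply: eq_Rintegral => y _; rewrite T.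
apply: etrans; first apply: (@green_iterated _ (phi \o sw) (partial2 phi \o sw)).
- by rewrite cross_swap oppr_eq0.
- by case: sa.
- by case: sb.
- by case: sc.
- exact/csp/test_continuous.
- exact/csp/test_partial2_continuous.
- by move=> y /=; apply: test_eq0 => /interior_square[/= _]; rewrite in_itv/= ltxx.
- by move=> x y; apply: is_derive_slice2; case: (test_derivable (y, x)).
by rewrite cross_swap sgrN.
Qed.

End TestFunctions.

(** * Geometry of triangulations *)

Section FiniteSums.
Context {V : finType} {M : nmodType}.
Implicit Types (F : V -> M) (a b c : V).

Lemma sum_supp2 F a b : a != b ->
  (forall v, v \notin [set a; b]%SET -> F v = 0) -> \sum_v F v = F a + F b.
Proof.
move=> ab F0; rewrite (bigD1 a)//= (bigD1 b) 1?eq_sym//= big1 ?addr0//.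
by move=> v /andP[va vb]; apply: F0; rewrite !inE negb_or va.
Qed.

Lemma sum_supp3 F a b c : a != b -> b != c -> c != a ->
  (forall v, v \notin [set a; b; c]%SET -> F v = 0) -> \sum_v F v = F a + F b + F c.
Proof.
move=> ab bc ca F0; rewrite (bigD1 a)//= (bigD1 b) 1?eq_sym//=.
rewrite (bigD1 c)/=; last by rewrite ca eq_sym.
rewrite big1 ?addr0 ?addrA// => v /andP[/andP[va vb] vc].
by apply: F0; rewrite !inE !negb_or va vb.
Qed.

End FiniteSums.

Section Hulls.
Context {R : realType} {V : finType}.
Variable p : V -> R * R.
Implicit Types (A B : {set V}) (a b c v w : V) (z : R * R).

Lemma fst_sum_scale (t : V -> R) :
  (\sum_v t v *: p v).1 = \sum_v t v * (p v).1.
Proof. by rewrite raddf_sum. Qed.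

Lemma snd_sum_scale (t : V -> R) :
  (\sum_v t v *: p v).2 = \sum_v t v * (p v).2.
Proof. by rewrite raddf_sum. Qed.

Lemma hull_subset A B : A \subset B -> hull p A `<=` hull p B.
Proof.
move=> AB z [t [t0 tA t1 ->]]; exists t; split => // v vB; apply: tA.
by apply: contra vB; exact: (fintype.subsetP AB v).
Qed.

(** The barycentric coordinates of [z] are the areas of the subtriangles divided by [d]; multiplying
    by [d] instead of dividing leaves their signs unchanged. *)
Lemma hullE3 a b c z : a != b -> b != c -> c != a ->
  cross (p a) (p b) (p c) != 0 ->
  hull p [set a; b; c]%SET z <->
  [/\ 0 <= cross (p a) (p b) z * cross (p a) (p b) (p c),
      0 <= cross (p b) (p c) z * cross (p a) (p b) (p c) &
      0 <= cross (p c) (p a) z * cross (p a) (p b) (p c)].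
Proof.
move=> ab bc ca d0; set d := cross (p a) (p b) (p c) in d0 *.
have dd : 0 < d * d by rewrite -expr2 exprn_even_gt0.
split => [[t [t0 tA t1 ->]]|[h1 h2 h3]].
  have s1 := sum_supp3 ab bc ca tA; rewrite t1 in s1.
  set z' := \sum_v _.
  have e1 : z'.1 = t a * (p a).1 + t b * (p b).1 + t c * (p c).1.
    by rewrite fst_sum_scale (sum_supp3 ab bc ca)// => v /tA ->; rewrite mul0r.
  have e2 : z'.2 = t a * (p a).2 + t b * (p b).2 + t c * (p c).2.
    by rewrite snd_sum_scale (sum_supp3 ab bc ca)// => v /tA ->; rewrite mul0r.
  have ta := t0 a; have tb := t0 b; have tc := t0 c.
  have sa : t a = 1 - t b - t c by rewrite s1; ring.
  have -> : cross (p a) (p b) z' = t c * d by rewrite /d /cross e1 e2 sa; ring.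
  have -> : cross (p b) (p c) z' = t a * d by rewrite /d /cross e1 e2 sa; ring.
  have -> : cross (p c) (p a) z' = t b * d by rewrite /d /cross e1 e2 sa; ring.
  by split; rewrite -mulrA mulr_ge0// ltW.
pose t v := if v == a then cross (p b) (p c) z / d else
  if v == b then cross (p c) (p a) z / d else
  if v == c then cross (p a) (p b) z / d else 0.
have ba : (b == a) = false by rewrite eq_sym; exact/negbTE.
have cb : (c == b) = false by rewrite eq_sym; exact/negbTE.
have ta : t a = cross (p b) (p c) z / d by rewrite /t eqxx.
have tb : t b = cross (p c) (p a) z / d by rewrite /t ba eqxx.
have tc : t c = cross (p a) (p b) z / d by rewrite /t (negbTE ca) cb eqxx.
have tA v : v \notin [set a; b; c]%SET -> t v = 0.
  by rewrite !inE !negb_or /t => /andP[/andP[/negbTE -> /negbTE ->] /negbTE ->].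
have q x : 0 <= x * d -> 0 <= x / d.
  move=> xd; rewrite (_ : x / d = x * d / (d * d)); last by field.
  by rewrite divr_ge0// ltW.
exists t; split => //.
- by move=> v; rewrite /t; do 3 (case: eqP => [_|_]; first exact: q).
- by rewrite (sum_supp3 ab bc ca)// ta tb tc -!mulrDl addrC addrA cross_sum divff.
- rewrite [LHS]surjective_pairing [RHS]surjective_pairing.
  rewrite fst_sum_scale snd_sum_scale.
  rewrite !(sum_supp3 ab bc ca) => [|v /tA ->|v /tA ->]; rewrite ?mul0r// ta tb tc.
  by move: d0; rewrite /d /cross => d0; congr pair; field.
Qed.

Lemma hullE2 v w z : v != w ->
  hull p [set v; w]%SET z <-> exists2 t, 0 <= t <= 1 & z = seg (p v) (p w) t.
Proof.
move=> vw; split => [[t [t0 tA t1 ->]]|[s /andP[s0 s1] ->]].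
  have := sum_supp2 vw tA; rewrite t1 => s1.
  exists (t w); first by have := t0 v; have := t0 w; lra.
  rewrite [LHS]surjective_pairing fst_sum_scale snd_sum_scale.
  rewrite !(sum_supp2 vw) => [|x /tA ->|x /tA ->]; rewrite ?mul0r//.
  have -> : t v = 1 - t w by rewrite s1; ring.
  by rewrite /seg; congr pair; ring.
pose t x := if x == v then 1 - s else if x == w then s else 0.
have wv : (w == v) = false by rewrite eq_sym; exact/negbTE.
have tA x : x \notin [set v; w]%SET -> t x = 0.
  by rewrite !inE !negb_or /t => /andP[/negbTE -> /negbTE ->].
have tv : t v = 1 - s by rewrite /t eqxx.
have tw : t w = s by rewrite /t wv eqxx.
exists t; split => //.
- by move=> x; rewrite /t; do 2 (case: eqP => [_|_]; first lra).
- by rewrite (sum_supp2 vw)// tv tw subrK.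
- rewrite [RHS]surjective_pairing fst_sum_scale snd_sum_scale.
  rewrite !(sum_supp2 vw) => [|x /tA ->|x /tA ->]; rewrite ?mul0r//.
  by rewrite tv tw /seg; congr pair; ring.
Qed.

Lemma hull_small A z z' : (#|A| <= 1)%N -> hull p A z -> hull p A z' -> z = z'.
Proof.
have aux v x : hull p [set v]%SET x -> x = p v.
  move=> [t [_ tA t1 ->]].
  have h w : w \notin [set v]%SET -> t w = 0 by exact: tA.
  rewrite (bigD1 v)//= big1 ?addr0.
    move: t1; rewrite (bigD1 v)//= big1 ?addr0 => [->|w wv]; first by rewrite scale1r.
    by apply: h; rewrite inE.
  by move=> w wv; rewrite h ?scale0r// inE.
rewrite leq_eqVlt ltnS leqn0 => /orP[/cards1P[v ->] /aux -> /aux ->//|].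
rewrite cards_eq0 => /eqP -> [t [_ tA t1 _]].
move: t1; rewrite big1 => [/eqP|v _]; first by rewrite eq_sym oner_eq0.
by rewrite tA// inE.
Qed.

(** Barycentric coordinates with respect to [f] are unique, so the two representations of the point
    coincide and vanish both off [A] and off [B]. *)
Lemma hullI_indep (f A B : {set V}) : affinely_independent p f ->
  A \subset f -> B \subset f -> hull p A `&` hull p B `<=` hull p (A :&: B).
Proof.
move=> indf Af Bf z [[s [s0 sA s1 zs]] [t [t0 tB t1 zt]]].
have st v : s v = t v.
  apply/eqP; rewrite -subr_eq0; apply/eqP; move: v; apply: indf.
  - move=> v vf; rewrite sA ?tB ?subrr//.
      by apply: contra vf; exact: (fintype.subsetP Bf v).
    by apply: contra vf; exact: (fintype.subsetP Af v).
  - by rewrite sumrB s1 t1 subrr.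
  - under eq_bigr do rewrite scalerBl.
    by rewrite sumrB -zs -zt subrr.
exists s; split => // v; rewrite inE negb_and => /orP[|vB]; first exact: sA.
by rewrite st tB.
Qed.

Lemma indep_cross a b c : a != b -> b != c -> c != a ->
  affinely_independent p [set a; b; c]%SET -> cross (p a) (p b) (p c) != 0.
Proof.
move=> ab bc ca ind; apply/eqP => d0.
have ba : (b == a) = false by rewrite eq_sym; exact/negbTE.
have cb : (c == b) = false by rewrite eq_sym; exact/negbTE.
have key (x y z : R) : x + y + z = 0 ->
    x * (p a).1 + y * (p b).1 + z * (p c).1 = 0 ->
    x * (p a).2 + y * (p b).2 + z * (p c).2 = 0 -> x = 0 /\ y = 0.
  move=> h0 h1 h2.
  pose t v := if v == a then x else if v == b then y else if v == c then z else 0.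
  have ta : t a = x by rewrite /t eqxx.
  have tb : t b = y by rewrite /t ba eqxx.
  have tc : t c = z by rewrite /t (negbTE ca) cb eqxx.
  have tA v : v \notin [set a; b; c]%SET -> t v = 0.
    by rewrite !inE !negb_or /t => /andP[/andP[/negbTE -> /negbTE ->] /negbTE ->].
  have t0 : forall v, t v = 0.
    apply: ind => //; first by rewrite (sum_supp3 ab bc ca)// ta tb tc.
    rewrite [LHS]surjective_pairing fst_sum_scale snd_sum_scale.
    by rewrite !(sum_supp3 ab bc ca) => [|v /tA ->|v /tA ->];
      rewrite ?mul0r// ta tb tc h1 h2.
  by rewrite -ta -tb !t0.
(* The differences of first coordinates sum to 0 and annihilate the first coordinates identically;
   on the second coordinates they give the vanishing determinant. So they form an affine
   dependence. *)
have [h1 h2] : (p b).1 - (p c).1 = 0 /\ (p c).1 - (p a).1 = 0.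
  apply: (key _ _ ((p a).1 - (p b).1)); try ring.
  by move: d0; rewrite /cross; lra.
have [h3 h4] : (p b).2 - (p c).2 = 0 /\ (p c).2 - (p a).2 = 0.
  apply: (key _ _ ((p a).2 - (p b).2)); try ring.
  by move: d0; rewrite /cross; lra.
(* The three points now coincide, so the coefficients 1, -1, 0 are an affine dependence. *)
have [/eqP] : 1 = 0 :> R /\ -1 = 0 :> R.
  by apply: (key _ _ 0); [ring|lra|lra].
by rewrite oner_eq0.
Qed.

End Hulls.

Lemma cross_seg (R : realType) (a b c d : R * R) t : cross a b (seg c d t) =
  (1 - t) * cross a b c + t * cross a b d.
Proof. by rewrite /cross /seg/=; ring. Qed.

Section TriangulationGeometry.
Context {R : realType} {V : finType}.
Variables (p : V -> R * R) (D : {set {set V}}).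
Hypothesis hD : triangulation p D square.
Implicit Types (A B e f g : {set V}) (a b c v w x y : V) (z : R * R).

Lemma face_indep f : f \in D -> affinely_independent p f.
Proof. by case: hD => + _ _ => /[apply] -[]. Qed.

Lemma face_card f : f \in D -> #|f| = 3%N.
Proof. by case: hD => + _ _ => /[apply] -[]. Qed.

Lemma hull_square f : f \in D -> hull p f `<=` square.
Proof. by move=> fD z fz; case: hD => _ _ <-; exists f. Qed.

Lemma face_split f v w : f \in D -> v != w -> ([set v; w]%SET \subset f) ->
  exists x, [/\ w != x, x != v, f = [set v; w; x]%SET
    & cross (p v) (p w) (p x) != 0].
Proof.
move=> fD vw ef.
have /cards1P[x xE] : #|f :\: [set v; w]%SET| == 1%N.
  by rewrite cardsD (finset.setIidPr ef) face_card// cards2 vw.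
have : x \in f :\: [set v; w]%SET by rewrite xE inE.
rewrite !inE negb_or => /andP[/andP[xv xw] xf].
have fE : f = [set v; w; x]%SET.
  apply/finset.setP => u; rewrite finset.in_setU -xE finset.in_setD.
  by case: (boolP (u \in [set v; w]%SET)) => //= /(fintype.subsetP ef).
have wx : w != x by rewrite eq_sym.
exists x; split => //; apply: indep_cross => //.
by rewrite -fE; exact: face_indep.
Qed.

Lemma face_vertices f : f \in D -> exists a b c,
  [/\ a != b, b != c, c != a & f = [set a; b; c]%SET] /\
  cross (p a) (p b) (p c) != 0.
Proof.
move=> fD; have : (1 < #|f|)%N by rewrite face_card.
case/card_gt1P => a [b [af bf ab]].
have ef : [set a; b]%SET \subset f.
  by apply/fintype.subsetP => x; rewrite !inE => /orP[] /eqP ->.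
have [c [bc ca fE d0]] := face_split fD ab ef.
by exists a, b, c.
Qed.

Lemma hull_vertex A v : v \in A -> hull p A (p v).
Proof.
move=> vA; exists (fun x => (x == v)%:R); split.
- by move=> x; rewrite ler0n.
- by move=> x xA; case: eqP => // e; move: xA; rewrite e vA.
- by rewrite (bigD1 v)//= eqxx big1 ?addr0// => x /negbTE ->.
- by rewrite (bigD1 v)//= eqxx scale1r big1 ?addr0// => x /negbTE ->; rewrite scale0r.
Qed.

Lemma vertex_square f v : f \in D -> v \in f -> square (p v).
Proof. by move=> fD vf; apply: hull_square fD _ _; exact: hull_vertex. Qed.

(** The triangulation puts the point in the hull of [f :&: g]; uniqueness of barycentric coordinates
    is then applied once inside [f] and once inside [g]. *)
Lemma hullI f g A B : f \in D -> g \in D -> A \subset f -> B \subset g ->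
  hull p A `&` hull p B `<=` hull p (A :&: B).
Proof.
move=> fD gD Af Bg z [Az Bz].
have hfg : hull p (f :&: g) z.
  case: hD => _ /(_ f g fD gD) <- _.
  by split; [exact: hull_subset Az|exact: hull_subset Bz].
have Agz : hull p (A :&: g) z.
  have := @hullI_indep _ _ _ _ A (f :&: g) (face_indep fD) Af
    (finset.subsetIl _ _) z (conj Az hfg).
  by rewrite finset.setIA (finset.setIidPl Af).
have := @hullI_indep _ _ _ _ (A :&: g) B (face_indep gD)
  (finset.subsetIr _ _) Bg z (conj Agz Bz).
by rewrite -finset.setIA (finset.setIC g) (finset.setIidPl Bg).
Qed.

(** An arbitrary orientation of the edge, taken from the enumeration of [V]. It cancels in the end,
    since [side] and the differences of end points change sign together. *)
Definition edge_ends e : (R * R) * (R * R) :=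
  if enum e is [:: v; w] then (p v, p w) else 0.

Lemma edgeP e : e \in edges D -> exists v w f,
  [/\ v != w, e = [set v; w]%SET, enum e = [:: v; w] & f \in faces_at D e].
Proof.
rewrite inE => /andP[/eqP c2 /existsP[f /andP[fD ef]]].
move: c2; rewrite cardE; case E: (enum e) => [|v [|w []]]//= _.
exists v, w, f; split => //; last by rewrite inE fD.
- by have := enum_uniq (mem e); rewrite E /= inE andbT.
- by apply/finset.setP => x; rewrite -mem_enum E !inE.
Qed.

Lemma faces_atP e f : reflect (f \in D /\ e \subset f) (f \in faces_at D e).
Proof. by rewrite inE; exact: andP. Qed.

Lemma edges_hullI e e' z z' : e \in edges D -> e' \in edges D -> e != e' ->
  hull p e z -> hull p e' z -> hull p e z' -> hull p e' z' -> z = z'.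
Proof.
move=> eD e'D ee' h1 h2 h3 h4.
have [v [w [f [_ _ _ /faces_atP[fD ef]]]]] := edgeP eD.
have [v' [w' [g [_ _ _ /faces_atP[gD eg]]]]] := edgeP e'D.
apply: (@hull_small _ _ p (e :&: e')).
- have c2 : #|e| = 2%N by move: eD; rewrite inE => /andP[/eqP].
  have c2' : #|e'| = 2%N by move: e'D; rewrite inE => /andP[/eqP].
  rewrite leqNgt; apply: contra ee' => h.
  have i1 : e :&: e' = e by apply/eqP; rewrite eqEcard finset.subsetIl c2.
  have i2 : e :&: e' = e' by apply/eqP; rewrite eqEcard finset.subsetIr c2'.
  by rewrite -i1 {1}i2.
- by apply: (hullI fD gD).
- by apply: (hullI fD gD).
Qed.

Lemma near0_affine_gt0 (q r : R) : 0 < q -> \forall t \near 0^'+, 0 < q + t * r.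
Proof.
move=> q0; have : q + t * r @[t --> 0^'+] --> q + 0 * r.
  by apply: cvg_at_right_filter; exact: continuous_affine.
rewrite mul0r addr0 => h; near=> t; near: t.
by apply: (cvgr_gt _ h).
Unshelve. all: by end_near. Qed.

(** Were [x] and [y] on the same side, a point [z] slightly off the midpoint of the edge towards
    [p x] would lie in both triangles, hence in the hull of their common edge; but [z] is not on the
    line of that edge. *)
Lemma opposite_sides v w x y : v != w ->
  [set v; w; x]%SET \in D -> [set v; w; y]%SET \in D ->
  w != x -> x != v -> w != y -> y != v -> x != y ->
  cross (p v) (p w) (p x) * cross (p v) (p w) (p y) < 0.
Proof.
move=> vw fD gD wx xv wy yv xy.
have df := indep_cross vw wx xv (face_indep fD).
have dg := indep_cross vw wy yv (face_indep gD).
rewrite ltNge le0r mulf_eq0 (negbTE df) (negbTE dg)/=; apply/negP => sgn.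
pose m := seg (p v) (p w) 2^-1.
set d := cross (p v) (p w) (p x) in df sgn *.
set d' := cross (p v) (p w) (p y) in dg sgn *.
have dd' : 0 < d' * d' by rewrite -expr2 exprn_even_gt0.
have dd : 0 < d * d by rewrite -expr2 exprn_even_gt0.
have h20 : 0 < 2^-1 :> R by rewrite invr_gt0.
have h21 : 0 < 1 - 2^-1 :> R by lra.
(* The two expressions affine in [t] below are the conditions for [z] to lie on the inner side of
   the other two edges of the second triangle. At the midpoint, [t = 0], both equal half of
   [d' * d'], so they stay positive for small [t]. *)
pose q1 := cross (p w) (p y) (p x) * d'.
pose q2 := cross (p y) (p v) (p x) * d'.
have [t [t0 t1 h1 h2]] : exists t, [/\ 0 < t, t < 1,
    0 < 2^-1 * (d' * d') + t * (q1 - 2^-1 * (d' * d')) &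
    0 < 2^-1 * (d' * d') + t * (q2 - 2^-1 * (d' * d'))].
  near (0 : R)^'+ => t; exists t; split; near: t.
  - exact: nbhs_right_gt.
  - exact: nbhs_right_lt.
  - by apply: near0_affine_gt0; rewrite mulr_gt0.
  - by apply: near0_affine_gt0; rewrite mulr_gt0.
pose z := seg m (p x) t.
have c1 : cross (p v) (p w) z = t * d.
  by rewrite /z cross_seg /m cross_seg -/d /cross; ring.
have fz : hull p [set v; w; x]%SET z.
  apply/hullE3 => //; rewrite c1 -/d; split.
  - by rewrite -mulrA mulr_ge0 ?ltW.
  - rewrite /z !cross_seg (_ : cross (p w) (p x) (p v) = d); last by rewrite cross_rot.
    rewrite (_ : cross _ _ (p w) = 0); last by rewrite /cross; ring.
    rewrite (_ : cross _ _ (p x) = 0); last by rewrite /cross; ring.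
    rewrite (_ : _ * d = (1 - t) * (1 - 2^-1) * (d * d)); last by ring.
    by apply: mulr_ge0; [apply: mulr_ge0|]; apply: ltW => //; rewrite subr_gt0.
  - rewrite /z !cross_seg (_ : cross (p x) (p v) (p w) = d); last by rewrite -(cross_rot (p x)).
    rewrite (_ : cross _ _ (p v) = 0); last by rewrite /cross; ring.
    rewrite (_ : cross _ _ (p x) = 0); last by rewrite /cross; ring.
    rewrite (_ : _ * d = (1 - t) * 2^-1 * (d * d)); last by ring.
    by apply: mulr_ge0; [apply: mulr_ge0|]; apply: ltW => //; rewrite subr_gt0.
have gz : hull p [set v; w; y]%SET z.
  apply/hullE3 => //; rewrite c1 -/d'; split.
  - by rewrite -mulrA mulr_ge0 ?ltW.
  - rewrite /z !cross_seg (_ : cross (p w) (p y) (p v) = d'); last by rewrite cross_rot.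
    rewrite (_ : cross _ _ (p w) = 0); last by rewrite /cross; ring.
    by move: h1; rewrite /q1; lra.
  - rewrite /z !cross_seg (_ : cross (p y) (p v) (p w) = d'); last by rewrite -(cross_rot (p y)).
    rewrite (_ : cross _ _ (p v) = 0); last by rewrite /cross; ring.
    by move: h2; rewrite /q2; lra.
have : hull p [set v; w]%SET z.
  have -> : [set v; w]%SET = [set v; w; x]%SET :&: [set v; w; y]%SET.
    apply/finset.setP => u; rewrite !inE.
    case: (u == v) => //=; case: (u == w) => //=; case: eqP => // ->.
    by rewrite (negbTE xy).
  by apply: (hullI fD gD).
move=> /(hullE2 _ _ vw)[s _ zs].
move: c1; rewrite zs cross_seg (_ : cross _ _ (p v) = 0); last by rewrite /cross; ring.
rewrite (_ : cross _ _ (p w) = 0); last by rewrite /cross; ring.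
by rewrite !mulr0 addr0 => /esym/eqP; rewrite mulf_eq0 (negbTE df) (gt_eqF t0).
Unshelve. all: by end_near. Qed.

End TriangulationGeometry.

Section EdgeInterior.
Context {R : realType} {V : finType}.
Variables (p : V -> R * R) (D : {set {set V}}).
Hypothesis hD : triangulation p D square.
Implicit Types (A B e f g : {set V}) (a b c v w x y : V) (z : R * R).

Lemma near_cross_gt0 (a b z : R * R) (k : R) : 0 < cross a b z * k ->
  \forall z' \near z, 0 < cross a b z' * k.
Proof.
have c : continuous (fun z' => cross a b z' * k).
  by move=> z'; apply: cvgM; [exact: cross_continuous|exact: cvg_cst].
by move=> h; exact: (cvgr_gt _ (c z)).
Qed.

Lemma cross_seg_gt0 (a b c : R * R) t : 0 < t < 1 -> cross a b c != 0 ->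
  0 < cross b c (seg a b t) * cross a b c /\
  0 < cross c a (seg a b t) * cross a b c.
Proof.
move=> /andP[t0 t1] d0; have dd : 0 < cross a b c * cross a b c.
  by rewrite -expr2 exprn_even_gt0.
rewrite !cross_seg (cross_rot a b c) -(cross_rot c a b).
have -> : cross b c b = 0 by rewrite /cross; ring.
have -> : cross c a a = 0 by rewrite /cross; ring.
rewrite !mulr0 addr0 add0r -!mulrA; split; apply: mulr_gt0 => //.
by rewrite subr_gt0.
Qed.

(** Near the point the inequalities of the four other sides are strict and persist. The sign
    relative to the common edge then decides which of the two triangles contains [z], as they lie on
    opposite sides. *)
Lemma edge_interior v w x y t : v != w ->
  [set v; w; x]%SET \in D -> [set v; w; y]%SET \in D ->
  w != x -> x != v -> w != y -> y != v -> x != y -> 0 < t < 1 ->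
  square° (seg (p v) (p w) t).
Proof.
move=> vw fD gD wx xv wy yv xy t01.
have op := opposite_sides hD vw fD gD wx xv wy yv xy.
have df := indep_cross vw wx xv (face_indep hD fD).
have dg := indep_cross vw wy yv (face_indep hD gD).
have [f1 f2] := cross_seg_gt0 t01 df; have [g1 g2] := cross_seg_gt0 t01 dg.
rewrite /interior/=; near=> z.
have [h|h] := leP 0 (cross (p v) (p w) z * cross (p v) (p w) (p x)).
  apply: (hull_square hD fD); apply/hullE3 => //; split => //.
    by apply: ltW; near: z; exact: near_cross_gt0.
  by apply: ltW; near: z; exact: near_cross_gt0.
apply: (hull_square hD gD); apply/hullE3 => //; split => //.
- by move: h op; nra.
- by apply: ltW; near: z; exact: near_cross_gt0.
- by apply: ltW; near: z; exact: near_cross_gt0.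
Unshelve. all: by end_near. Qed.

Lemma near_notin_hull g z z' : g \in D -> ~ hull p g z ->
  \forall t \near 0^'+, ~ hull p g (seg z z' t).
Proof.
move=> gD; have [a [b [c [[ab bc ca ->] d0]]]] := face_vertices hD gD.
have key (u v : V) (d : R) : cross (p u) (p v) z * d < 0 ->
    \forall t \near 0^'+, cross (p u) (p v) (seg z z' t) * d < 0.
  move=> neg; near=> t; rewrite cross_seg.
  have : 0 < - (cross (p u) (p v) z * d) +
      t * ((cross (p u) (p v) z - cross (p u) (p v) z') * d).
    by near: t; apply: near0_affine_gt0; rewrite oppr_gt0.
  by lra.
set d := cross (p a) (p b) (p c) in d0 *.
have [h1|h1] := ltP (cross (p a) (p b) z * d) 0.
  move=> _; near=> t => /(hullE3 _ ab bc ca d0)[+ _ _]; apply/negP.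
  by rewrite -ltNge; near: t; exact: key.
have [h2|h2] := ltP (cross (p b) (p c) z * d) 0.
  move=> _; near=> t => /(hullE3 _ ab bc ca d0)[_ + _]; apply/negP.
  by rewrite -ltNge; near: t; exact: key.
have [h3|h3] := ltP (cross (p c) (p a) z * d) 0.
  move=> _; near=> t => /(hullE3 _ ab bc ca d0)[_ _ +]; apply/negP.
  by rewrite -ltNge; near: t; exact: key.
by move=> []; apply/hullE3.
Unshelve. all: by end_near. Qed.

(** Leave the edge away from [x]. Close to an interior point of the square one stays in the square,
    yet in no triangle: faces missing [z] are still missed, and a face containing [z] contains the
    whole edge, so it is the only face, which is being left. *)
Lemma edge_boundary v w x t : v != w ->
  faces_at D [set v; w]%SET = [set [set v; w; x]]%SET ->
  w != x -> x != v -> 0 < t < 1 ->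
  ~ square° (seg (p v) (p w) t).
Proof.
move=> vw fs wx xv t01 int.
have /faces_atP[fD ef] : [set v; w; x]%SET \in faces_at D [set v; w]%SET.
  by rewrite fs finset.in_set1.
have df := indep_cross vw wx xv (face_indep hD fD).
have dd : 0 < cross (p v) (p w) (p x) * cross (p v) (p w) (p x).
  by rewrite -expr2 exprn_even_gt0.
set z := seg (p v) (p w) t in int.
(* The reflection of [p x] in [z], which lies strictly on the other side of the edge. *)
pose z' := (2 * z.1 - (p x).1, 2 * z.2 - (p x).2).
have cz : cross (p v) (p w) z = 0 by rewrite /z /cross /seg/=; ring.
have cz' : cross (p v) (p w) z' = - cross (p v) (p w) (p x).
  transitivity (2 * cross (p v) (p w) z - cross (p v) (p w) (p x)).
    by rewrite /cross /z'/=; ring.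
  by rewrite cz mulr0 add0r.
have out g : g \in D -> \forall s \near 0^'+, ~ hull p g (seg z z' s).
  move=> gD; have [gz|gz] := pselect (hull p g z); last exact: near_notin_hull.
  have ez : hull p [set v; w]%SET z.
    by apply/hullE2 => //; exists t => //; case/andP: t01 => *; rewrite !ltW.
  have egz := hullI hD fD gD ef (fintype.subxx _) (conj ez gz).
  have eg : [set v; w]%SET \subset g.
    have [h1 h2] := cross_seg_gt0 t01 df; rewrite -/z in h1 h2.
    (* If [g] missed an end of the edge, [z] would lie in the hull of the other end alone; but it is
       strictly between the two. *)
    have only u u' : [set v; w]%SET = [set u; u']%SET -> u \notin g -> z = p u'.
      move=> e ug; apply: (@hull_small _ _ p [set u']%SET); first by rewrite cards1.
        apply: hull_subset egz; apply/fintype.subsetP => s; rewrite e !inE.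
        by case: eqP => [->|_]; rewrite ?(negbTE ug) ?andbF//= => /andP[].
      by apply: hull_vertex; rewrite finset.in_set1.
    apply/fintype.subsetP => s; rewrite !inE => /orP[] /eqP ->; apply/negPn/negP.
      move=> /(only _ _ erefl) zw; move: h1; rewrite zw.
      by rewrite (_ : cross _ _ _ = 0) ?mul0r ?ltxx// /cross; ring.
    move=> /(only w v (finset.setUC _ _)) zv; move: h2; rewrite zv.
    by rewrite (_ : cross _ _ _ = 0) ?mul0r ?ltxx// /cross; ring.
  have -> : g = [set v; w; x]%SET.
    by apply/eqP; rewrite -finset.in_set1 -fs; apply/faces_atP.
  near=> s => /(hullE3 _ vw wx xv df)[+ _ _]; apply/negP; rewrite -ltNge.
  rewrite cross_seg cz cz' mulr0 add0r mulrN mulNr oppr_lt0 -mulrA mulr_gt0//.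
have sq : \forall s \near 0^'+, square (seg z z' s).
  have c : seg z z' s @[s --> 0^'+] --> seg z z' 0.
    by apply: cvg_at_right_filter; exact: seg_continuous.
  rewrite (_ : seg z z' 0 = z) in c; last first.
    by rewrite [RHS]surjective_pairing /seg !mul0r !addr0.
  exact: c int.
have : \forall s \near 0^'+, forall g, g \in D -> ~ hull p g (seg z z' s).
  apply: filter_forall => g; have [gD|gD] := boolP (g \in D); last by near=> s.
  by have := out g gD; apply: filterS.
move=> out'.
have [s [h1 h2]] : exists s, square (seg z z' s) /\
    forall g, g \in D -> ~ hull p g (seg z z' s).
  by near (0 : R)^'+ => s; exists s; split; near: s.
case: hD => _ _ cov; move: h1; rewrite -cov => -[g /= gD].
exact: h2.
Unshelve. all: by end_near. Qed.

End EdgeInterior.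

(** * Linear combinations of measures *)

Lemma fin_sub_eq (R : realDomainType) (x y z w : \bar R) :
  x \is a fin_num -> y \is a fin_num -> z \is a fin_num -> w \is a fin_num ->
  (x - y = z - w -> z + y = x + w)%E.
Proof.
case: x => // x; case: y => // y; case: z => // z; case: w => // w _ _ _ _.
rewrite -!EFinB -!EFinD => -[e]; congr EFin.
by rewrite -[z](subrK w) -e; ring.
Qed.

Section ChargeIntegral.
Context d (T : measurableType d) (R : realType).
Implicit Types (m P N : {measure set T -> \bar R}).
Variables (A : set T) (mA : measurable A) (f : T -> R).
Hypothesis mf : measurable_fun setT f.
Variable M : R.
Hypothesis bf : forall x, A x -> `|f x| <= M.

Lemma bounded_integrable m : (m A < +oo)%E -> m.-integrable A (EFin \o f).
Proof.
move=> mfin; apply: measurable_bounded_integrable => //; first exact: measurable_funTS.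
exists M; split; first exact: num_real.
by move=> x Mx z Az; apply: le_trans (ltW Mx); exact: bf.
Qed.

Lemma Rintegral_measure_add m1 m2 : (m1 A < +oo)%E -> (m2 A < +oo)%E ->
  \int[measure_add m1 m2]_(x in A) f x =
  \int[m1]_(x in A) f x + \int[m2]_(x in A) f x.
Proof.
move=> f1 f2; have i1 := bounded_integrable f1; have i2 := bounded_integrable f2.
rewrite /Rintegral integral_measure_add//.
by rewrite fineD//; exact: integrable_fin_num.
Qed.

Lemma Rintegral_mscale m (k : {nonneg R}) : (m A < +oo)%E ->
  \int[mscale k m]_(x in A) f x = k%:num * \int[m]_(x in A) f x.
Proof.
move=> mfin; have i := bounded_integrable mfin.
have mEf : measurable_fun A (EFin \o f) by apply/measurable_EFinP; exact: measurable_funTS.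
rewrite /Rintegral integralE !ge0_integral_mscale//; last 2 first.
- exact: measurable_funeneg.
- exact: measurable_funepos.
rewrite -muleBr//.
  by rewrite -integralE fineM//; exact: integrable_fin_num.
apply: fin_num_adde_defl; rewrite fin_numN.
exact: integrable_neg_fin_num.
Qed.

(** Rearranged without subtraction, the two splittings say that the positive part plus [N] and [P]
    plus the negative part are the same measure. Integrating and subtracting again is legitimate
    because everything is finite. *)
Lemma charge_integralE (c : {charge set T -> \bar R}) P N :
  (P setT < +oo)%E -> (N setT < +oo)%E ->
  (forall B, measurable B -> c B = (P B - N B)%E) ->
  charge_integral c A f = \int[P]_(x in A) f x - \int[N]_(x in A) f x.
Proof.
move=> Pfin Nfin cPN; rewrite /charge_integral.
set h := projT2 (cid (projT2 (cid (Hahn_decomposition c)))).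
have fin m B : (m setT < +oo)%E -> measurable B -> (m B < +oo)%E.
  by move=> mfin mB; apply: le_lt_trans mfin; apply: le_measure; rewrite ?inE.
have finb m B : (m setT < +oo)%E -> measurable B -> m B \is a fin_num.
  by move=> mfin mB; rewrite ge0_fin_numE//; exact: fin.
have jp : (jordan_pos h setT < +oo)%E by rewrite -ge0_fin_numE// fin_num_measure.
have jn : (jordan_neg h setT < +oo)%E by rewrite -ge0_fin_numE// fin_num_measure.
have E : \int[measure_add (jordan_pos h) N]_(x in A) f x =
    \int[measure_add P (jordan_neg h)]_(x in A) f x; last first.
  move: E; rewrite Rintegral_measure_add; [|exact: fin|exact: fin].
  rewrite Rintegral_measure_add; [|exact: fin|exact: fin].
  by move=> E; apply/eqP; rewrite subr_eq addrAC eq_sym subr_eq E addrC.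
rewrite /Rintegral; congr fine; apply: eq_measure_integral => B mB _.
rewrite [LHS]measure_addE [RHS]measure_addE; apply: fin_sub_eq; try exact: finb.
by have := jordan_decomp h mB; rewrite cPN// /cadd/= cscaleN1.
Qed.

Variable I : Type.
Variables (kappa : I -> R) (rho : I -> {finite_measure set T -> \bar R}).

Fixpoint charge_comb (r : seq I) : {charge set T -> \bar R} :=
  if r is i :: r' then
    cadd (cscale (kappa i) (charge_of_finite_measure (rho i))) (charge_comb r')
  else czero.

Lemma charge_combE r B : measurable B ->
  charge_comb r B = (\sum_(i <- r) kappa i * fine (rho i B))%:E.
Proof.
move=> mB; elim: r => [|i r ih]; first by rewrite big_nil.
rewrite big_cons /= /cadd ih/= /cscale/= EFinD EFinM.
by rewrite fineK//; exact: fin_num_measure.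
Qed.

(** Terms with nonnegative coefficient are collected in [P], the absolute values of the others in
    [N]. These need not be mutually singular, which [charge_integralE] allows. *)
Lemma charge_comb_integral r : charge_integral (charge_comb r) A f =
  \sum_(i <- r) kappa i * \int[rho i]_(x in A) f x.
Proof.
have fin m B : (m setT < +oo)%E -> measurable B -> (m B < +oo)%E.
  by move=> mfin mB; apply: le_lt_trans mfin; apply: le_measure; rewrite ?inE.
have rfin i B : measurable B -> (rho i B < +oo)%E.
  by move=> mB; rewrite -ge0_fin_numE// fin_num_measure.
suff [P [N [Pfin Nfin e <-]]] : exists P N, [/\ (P setT < +oo)%E, (N setT < +oo)%E,
   forall B, measurable B -> charge_comb r B = (P B - N B)%E &
   \int[P]_(x in A) f x - \int[N]_(x in A) f x =
   \sum_(i <- r) kappa i * \int[rho i]_(x in A) f x].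
  exact: charge_integralE.
elim: r => [|i r [P [N [Pfin Nfin e E]]]].
  exists mzero, mzero; split.
  - exact: ltry.
  - exact: ltry.
  - by move=> B _; rewrite /= /mzero sube0.
  - by rewrite big_nil subrr.
have scfin (k : {nonneg R}) B : measurable B -> mscale k (rho i) B \is a fin_num.
  by move=> mB; rewrite /mscale fin_numM//; exact: fin_num_measure.
have scT (k : {nonneg R}) : (mscale k (rho i) setT < +oo)%E.
  by rewrite -ge0_fin_numE//; exact: scfin.
have scA (k : {nonneg R}) : (mscale k (rho i) A < +oo)%E.
  by rewrite -ge0_fin_numE//; exact: scfin.
have [k0|k0] := leP 0 (kappa i).
  pose k := NngNum k0; exists (measure_add (mscale k (rho i)) P), N; split.
  - by rewrite [ltLHS]measure_addE; apply: lte_add_pinfty; rewrite ?scT.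
  - exact: Nfin.
  - by move=> B mB; rewrite [LHS]/= /cadd/= e// [X in _ = (X - _)%E]measure_addE addeA.
  - rewrite Rintegral_measure_add; [|exact: scA|exact: fin].
    by rewrite Rintegral_mscale ?rfin// big_cons -E /=; ring.
have k0' : 0 <= - kappa i by rewrite oppr_ge0 ltW.
pose k := NngNum k0'; exists P, (measure_add (mscale k (rho i)) N); split.
- exact: Pfin.
- by rewrite [ltLHS]measure_addE; apply: lte_add_pinfty; rewrite ?scT.
- move=> B mB; rewrite [LHS]/= /cadd/= e// [X in _ = (_ - X)%E]measure_addE /cscale/=.
  rewrite oppeD; last by rewrite fin_num_adde_defr// scfin.
  by rewrite /mscale/= EFinN mulNe oppeK addeCA.
- rewrite Rintegral_measure_add; [|exact: scA|exact: fin].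
  rewrite Rintegral_mscale ?rfin// big_cons -E /=; ring.
Qed.

End ChargeIntegral.

(** * Euclidean norms and the total variation of a matrix of charges *)

Section EuclideanNorm.
Context {R : realType} {J : finType}.
Implicit Types a b : J -> R.

(** Lagrange's identity: the defect is half the sum of the squares of all 2 by 2 minors. *)
Lemma cauchy_schwarz a b :
  (\sum_j a j * b j) ^+ 2 <= (\sum_j a j ^+ 2) * (\sum_j b j ^+ 2).
Proof.
have : 0 <= \sum_i \sum_j (a i * b j - a j * b i) ^+ 2.
  by apply: sumr_ge0 => i _; apply: sumr_ge0 => j _; exact: sqr_ge0.
suff -> : \sum_i \sum_j (a i * b j - a j * b i) ^+ 2 =
    2 * ((\sum_j a j ^+ 2) * (\sum_j b j ^+ 2) - (\sum_j a j * b j) ^+ 2).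
  by rewrite pmulr_rge0// subr_ge0.
have E i j : (a i * b j - a j * b i) ^+ 2 =
    a i ^+ 2 * b j ^+ 2 + b i ^+ 2 * a j ^+ 2 - 2 * ((a i * b i) * (a j * b j)).
  by ring.
under eq_bigr do under eq_bigr do rewrite E.
under eq_bigr do rewrite sumrB big_split/= -!mulr_sumr.
rewrite sumrB big_split/= -!mulr_suml -mulr_sumr -mulr_suml; ring.
Qed.

Lemma l2norm_add a b : Num.sqrt (\sum_j (a j + b j) ^+ 2) <=
  Num.sqrt (\sum_j a j ^+ 2) + Num.sqrt (\sum_j b j ^+ 2).
Proof.
have s0 (c : J -> R) : 0 <= \sum_j c j ^+ 2 by apply: sumr_ge0 => j _; exact: sqr_ge0.
rewrite -(ler_pXn2r (n := 2))// ?nnegrE ?addr_ge0 ?sqrtr_ge0//.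
rewrite sqr_sqrtr// sqrrD !sqr_sqrtr//.
have -> : \sum_j (a j + b j) ^+ 2 =
    \sum_j a j ^+ 2 + (\sum_j a j * b j) *+ 2 + \sum_j b j ^+ 2.
  by rewrite -sumrMnl -!big_split/=; apply: eq_bigr => j _; rewrite sqrrD.
rewrite lerD2r lerD2l lerMn2r/= -sqrtrM//.
apply: le_trans (ler_norm _) _; rewrite -sqrtr_sqr ler_sqrt ?cauchy_schwarz//.
exact: mulr_ge0.
Qed.

Lemma l2norm_scale (k : R) a : 0 <= k ->
  Num.sqrt (\sum_j (k * a j) ^+ 2) = k * Num.sqrt (\sum_j a j ^+ 2).
Proof.
move=> k0; under eq_bigr do rewrite exprMn.
by rewrite -mulr_sumr sqrtrM ?sqr_ge0// sqrtr_sqr ger0_norm.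
Qed.

Lemma l2norm_sum (I : Type) (r : seq I) (a : I -> J -> R) :
  Num.sqrt (\sum_j (\sum_(i <- r) a i j) ^+ 2) <=
  \sum_(i <- r) Num.sqrt (\sum_j a i j ^+ 2).
Proof.
elim: r => [|i r ih].
  rewrite big_nil big1 ?sqrtr0// => j _; by rewrite big_nil expr0n.
under eq_bigr do rewrite big_cons.
by rewrite big_cons (le_trans (l2norm_add _ _))// lerD2l.
Qed.

End EuclideanNorm.

Section TotalVariation.
Context d (T : measurableType d) (R : realType) (I : eqType) (p q : nat).
Variables (kappa : I -> 'I_p -> 'I_q -> R).
Variables (rho : I -> {finite_measure set T -> \bar R}) (H : I -> set T).
Variable r : seq I.
Hypotheses (ur : uniq r) (mH : forall i, measurable (H i)).
Hypothesis rhoH : forall i, i \in r -> rho i (~` H i) = 0%E.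
Hypothesis rhoH' : forall i j, i \in r -> j \in r -> i != j -> rho i (H j) = 0%E.

Definition comb_matrix j k := charge_comb (fun i => kappa i j k) rho r.

Definition l2norm_matrix (a : 'I_p -> 'I_q -> R) : R :=
  Num.sqrt (\sum_j \sum_k a j k ^+ 2).

Lemma charge_normE B : measurable B -> charge_norm comb_matrix B =
  Num.sqrt (\sum_(jk : 'I_p * 'I_q)
    (\sum_(i <- r) fine (rho i B) * kappa i jk.1 jk.2) ^+ 2).
Proof.
move=> mB; rewrite /charge_norm pair_big/=; congr Num.sqrt.
apply: eq_bigr => jk _; rewrite charge_combE//=; congr (_ ^+ 2).
by apply: eq_bigr => i _; rewrite mulrC.
Qed.

Lemma l2norm_matrixE (a : 'I_p -> 'I_q -> R) :
  l2norm_matrix a = Num.sqrt (\sum_(jk : 'I_p * 'I_q) a jk.1 jk.2 ^+ 2).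
Proof. by rewrite /l2norm_matrix pair_big. Qed.

Lemma charge_norm_le B : measurable B -> charge_norm comb_matrix B <=
  \sum_(i <- r) fine (rho i B) * l2norm_matrix (kappa i).
Proof.
move=> mB; rewrite charge_normE//; apply: le_trans (l2norm_sum _ _) _.
apply: ler_sum => i _; rewrite l2norm_matrixE.
by rewrite (l2norm_scale (fun jk => kappa i jk.1 jk.2))// fine_ge0.
Qed.

Lemma charge_norm_single i B : i \in r -> measurable B ->
  (forall j, j \in r -> j != i -> rho j B = 0%E) ->
  charge_norm comb_matrix B = fine (rho i B) * l2norm_matrix (kappa i).
Proof.
move=> ir mB B0; rewrite charge_normE// l2norm_matrixE -l2norm_scale ?fine_ge0//.
congr Num.sqrt; apply: eq_bigr => jk _; congr (_ ^+ 2).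
rewrite (bigD1_seq i)//= big_seq_cond big1 ?addr0// => j /andP[jr ji].
by rewrite B0// mul0r.
Qed.

Lemma rho_setD_null i B C : i \in r -> measurable B -> measurable C -> C `<=` B ->
  rho i (B `\` C) = 0%E -> rho i C = rho i B.
Proof.
move=> ir mB mC CB e; rewrite -(setDUK CB) measureU//; [|exact: measurableD|exact: setDIK].
by rewrite [X in (_ = _ + X)%E]e adde0.
Qed.

Lemma le_total_variation A (G : nat -> set T) n :
  (forall k, measurable (G k)) -> \bigcup_k G k = A ->
  ((\sum_(k < n) charge_norm comb_matrix (seqDU G k))%:E <=
   vector_total_variation comb_matrix A)%E.
Proof.
move=> mG GA; apply: (@le_trans _ _
  (\sum_(0 <= k <oo) (charge_norm comb_matrix (seqDU G k))%:E)%E).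
  rewrite -sumEFin -(big_mkord xpredT (fun k => (charge_norm comb_matrix (seqDU G k))%:E)).
  by apply: nneseries_lim_ge => k _ _; rewrite lee_fin sqrtr_ge0.
apply: ereal_sup_ubound; exists (seqDU G) => //; split => //.
- exact: seqDU_measurable.
- by rewrite -seqDU_bigcup_eq.
Qed.

(** The upper bound is the triangle inequality on each piece, followed by countable additivity. For
    the lower bound, a partition of [A] subordinate to the carriers [H i] is exhibited: on each of
    its pieces only one [rho i] is alive, so no cancellation occurs. *)
Lemma vector_total_variation_comb A : measurable A ->
  vector_total_variation comb_matrix A =
  (\sum_(i <- r) fine (rho i A) * l2norm_matrix (kappa i))%:E.
Proof.
move=> mA.
have l0 i : 0 <= l2norm_matrix (kappa i) by exact: sqrtr_ge0.
apply/eqP; rewrite eq_le; apply/andP; split.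
  apply: ge_ereal_sup => _ [F [mF tF FA] <-].
  apply: (@le_trans _ _ (\sum_(0 <= n <oo)
      \sum_(i <- r) (l2norm_matrix (kappa i))%:E * rho i (F n)))%E.
    apply: lee_nneseries => [n _ _|n _]; first by rewrite lee_fin sqrtr_ge0.
    apply: (@le_trans _ _ (\sum_(i <- r) fine (rho i (F n)) * l2norm_matrix (kappa i))%:E).
      by rewrite lee_fin charge_norm_le.
    rewrite -sumEFin lee_sum// => i _.
    by rewrite EFinM muleC fineK// fin_num_measure.
  rewrite nneseries_sum; last by move=> i n _; rewrite mule_ge0// lee_fin.
  rewrite -sumEFin lee_sum// => i _.
  rewrite nneseriesZl// -measure_semi_bigcup//; last by rewrite FA.
  by rewrite FA EFinM muleC fineK// fin_num_measure.
have [r0|[i0]] : r = [::] \/ inhabited I by case: (r) => [|i ?]; [left|right].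
  rewrite r0 big_nil.
  (* For an empty list the empty partial sum bounds the variation below by 0. This case is apart
     because [nth] below needs a default element of [I]. *)
  have := @le_total_variation A (fun=> A) 0 (fun=> mA).
  by rewrite big_ord0; apply; rewrite bigcup_const.
(* From index [size r] on the sets equal [A], so that the union is [A]; [seqDU] then makes them
   disjoint. *)
pose G k := if (k < size r)%N then H (nth i0 r k) `&` A else A.
have mG k : measurable (G k) by rewrite /G; case: ifP => // _; exact: measurableI.
have GA : \bigcup_k G k = A.
  apply/seteqP; split => [x [k _]|x Ax]; first by rewrite /G; case: ifP => // _ [].
  by exists (size r) => //; rewrite /G ltnn.
apply: le_trans (le_total_variation (size r) mG GA).
rewrite lee_fin (big_nth i0) big_mkord; apply: ler_sum => -[k kr] _ /=.
set i := nth i0 r k; have ir : i \in r by exact: mem_nth.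
have mF : measurable (seqDU G k) by exact: seqDU_measurable.
have FH : seqDU G k `<=` H i `&` A.
  by move=> x /(@subset_seqDU _ G k); rewrite /G kr.
rewrite (charge_norm_single ir mF); last first.
  move=> j jr ji.
  apply: (@subset_measure0 _ _ _ (rho j) _ (H i)) => //; last exact: rhoH'.
  by move=> x /FH[].
rewrite (rho_setD_null ir mA mF)//; first by move=> x /FH[].
(* Piece [k] differs from [A] only outside its own carrier or inside an earlier one, and [rho i]
   neglects both. *)
pose N := ~` H i `|` \big[setU/set0]_(j < k) H (nth i0 r j).
have mN : measurable N.
  apply: measurableU; first exact: measurableC.
  by apply: bigsetU_measurable.
apply: (@subset_measure0 _ _ _ (rho i) _ N) => //.
- exact: measurableD.
- move=> x [Ax nF]; have [Hx|Hx] := pselect (H i x); last by left.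
  right; apply: contrapT => nU; apply: nF; split; first by rewrite /G kr.
  apply: contra_not nU; rewrite -!bigcup_mkord => -[j /= jk].
  rewrite /G (ltn_trans jk kr) => -[Hj _].
  by rewrite -(bigcup_mkord k (fun j => H (nth i0 r j))); exists j.
- apply/eqP; rewrite -measure_le0.
  have mU : measurable (\big[setU/set0]_(j < k) H (nth i0 r j)).
    exact: bigsetU_measurable.
  apply: (le_trans (measureU2 (rho i) (measurableC (mH i)) mU)).
  rewrite [X in (X + _)%E]rhoH// add0e.
  have le := @Boole_inequality _ _ _ (rho i) (fun j => H (nth i0 r j)) k (fun j _ => mH _).
  apply: (le_trans le); rewrite [leLHS]big1// => j _; apply: rhoH' => //.
    by apply: mem_nth; exact: ltn_trans kr.
  rewrite nth_uniq// ?(ltn_trans _ kr)//.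
  by apply/negP => /eqP e; move: (ltn_ord j); rewrite -e ltnn.
Qed.

End TotalVariation.

(** * Arc measures of edges *)

Section EdgeMeasure.
Context {R : realType}.
Notation mu := (@lebesgue_measure R).
Notation mR := (measurableTypeR R).
Implicit Types (A B : set (mR * mR)).

Definition segment (a b : R * R) : set (mR * mR) := seg a b @` `[0, 1].

Lemma measurable_square_interior : measurable (square° : set (mR * mR)).
Proof. by apply: open_measurable_plane; exact: open_interior. Qed.

Lemma measurable_segment a b : measurable (segment a b).
Proof.
rewrite -[segment a b]setCK; apply: measurableC.
apply: open_measurable_plane; apply: closed_openC.
apply: compact_closed; first exact: norm_hausdorff.
apply: continuous_compact; last exact: segment_compact.
by apply: continuous_subspaceT; exact: seg_continuous.
Qed.

Lemma measurable_seg a b : measurable_fun setT (seg a b : mR -> mR * mR).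
Proof.
by apply: measurable_fun_pair; apply: measurable_realfun.continuous_measurable_fun;
  exact: continuous_affine.
Qed.

Variables (a b : R * R).

(* The parametrization by [0, 1] is not unit speed: [edge_measure] has mass 1 on
   an edge inside the square, and lengths are carried by the weights. *)
Definition edge_trace A : set mR := `[0, 1] `&` seg a b @^-1` (A `&` square°).

(** The open square is built into the trace, so an edge on the boundary automatically has mass 0 and
    all edges can be summed alike. *)
Definition edge_measure A : \bar R := mu (edge_trace A).

Lemma measurable_edge_trace A : measurable A -> measurable (edge_trace A).
Proof.
move=> mA; apply: measurableI => //; rewrite -[X in measurable X]setTI.
by apply: measurable_seg => //; exact: measurableI _ measurable_square_interior.
Qed.

Let edge_measure0 : edge_measure set0 = 0%E.
Proof. by rewrite /edge_measure /edge_trace set0I preimage_set0 setI0. Qed.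

Let edge_measure_ge0 A : (0 <= edge_measure A)%E.
Proof. exact: measure_ge0. Qed.

Let edge_measure_sigma_additive : semi_sigma_additive edge_measure.
Proof.
move=> F mF tF mUF; rewrite /edge_measure.
have -> : edge_trace (\bigcup_n F n) = \bigcup_n edge_trace (F n).
  apply/seteqP; split => [t [t01 [[n _ Fn] int]]|t [n _ [t01 [Fn int]]]].
    by exists n.
  by split => //; split => //; exists n.
apply: measure_semi_sigma_additive.
- by move=> n; exact: measurable_edge_trace.
- apply/trivIsetP => i j _ _ ij; apply/seteqP; split => // t [[_ [Fi _]] [_ [Fj _]]].
  have /trivIsetP/(_ i j I I ij) e := tF.
  have : (F i `&` F j) (seg a b t) by [].
  by rewrite e.
- by apply: bigcupT_measurable => n; exact: measurable_edge_trace.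
Qed.

HB.instance Definition _ := isMeasure.Build _ _ _ edge_measure
  edge_measure0 edge_measure_ge0 edge_measure_sigma_additive.

Lemma lebesgue_itv01 : mu `[0, 1] = 1%E.
Proof. by rewrite lebesgue_measure_itv/= lte_fin ltr01 oppr0 adde0. Qed.

Let edge_measure_fin : fin_num_fun edge_measure.
Proof.
move=> A mA; rewrite ge0_fin_numE//.
apply: (@le_lt_trans _ _ (mu `[0, 1])); last by rewrite lebesgue_itv01 ltry.
apply: le_measure; rewrite ?inE//; first exact: measurable_edge_trace.
exact: subIsetl.
Qed.

HB.instance Definition _ := Measure_isFinite.Build _ _ _ edge_measure edge_measure_fin.

Lemma set2_null (x y : R) : mu [set x; y] = 0%E.
Proof. by apply: countable_lebesgue_measure0; exact/finite_set_countable/finite_set2. Qed.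

Lemma edge_measure_null A : measurable A ->
  (forall s t, 0 <= s <= 1 -> 0 <= t <= 1 -> A (seg a b s) -> A (seg a b t) -> s = t) ->
  edge_measure A = 0%E.
Proof.
move=> mA inj; have mt := measurable_edge_trace mA.
have [[t [t01 [At _]]]|nA] := pselect (edge_trace A !=set0).
  apply: (@subset_measure0 _ _ _ mu _ [set t : mR]) => //; last exact: lebesgue_measure_set1.
  by move=> s [s01 [As _]] /=; apply: inj.
rewrite /edge_measure (_ : edge_trace A = set0) ?measure0//.
by apply/seteqP; split => // t At; case: nA; exists t.
Qed.

Lemma edge_measure_full A : measurable A ->
  (forall t, 0 < t < 1 -> A (seg a b t) /\ square° (seg a b t)) ->
  edge_measure A = 1%E.
Proof.
move=> mA full; have mt := measurable_edge_trace mA.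
apply/eqP; rewrite eq_le; apply/andP; split.
  rewrite -lebesgue_itv01; apply: le_measure; rewrite ?inE//.
  exact: subIsetl.
have -> : (1 : \bar R)%E = mu `]0, 1[.
  by rewrite lebesgue_measure_itv/= lte_fin ltr01 oppr0 adde0.
apply: le_measure; rewrite ?inE// => t; rewrite /= in_itv/= => t01.
have [At int] := full t t01; split; last by split.
by rewrite /= in_itv/=; lra.
Qed.

Lemma edge_measure_boundary A : measurable A ->
  (forall t, 0 < t < 1 -> ~ square° (seg a b t)) -> edge_measure A = 0%E.
Proof.
move=> mA out; have mt := measurable_edge_trace mA.
apply: (@subset_measure0 _ _ _ mu _ ([set 0; 1] : set mR)) => //; last exact: set2_null.
  by apply: measurableU.
move=> t [/=]; rewrite in_itv/= => t01 [_ int].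
have [t0|t0] := eqVneq t 0; first by left.
have [t1|t1] := eqVneq t 1; first by right.
exfalso; apply: out int; move: t0 t1; rewrite !neq_lt; lra.
Qed.

Lemma edge_measure_out A : A `&` square° = set0 -> edge_measure A = 0%E.
Proof. by move=> e; rewrite /edge_measure /edge_trace e preimage_set0 setI0 measure0. Qed.

Lemma edge_measure_segmentC A : A `&` segment a b = set0 -> edge_measure A = 0%E.
Proof.
move=> e; rewrite /edge_measure (_ : edge_trace A = set0) ?measure0//.
apply/seteqP; split => // t [t01 [At _]].
have : (A `&` segment a b) (seg a b t) by split => //; exists t.
by rewrite e.
Qed.

(** On the open square [edge_measure] is the image under [seg a b] of Lebesgue measure on [0, 1], so
    the change of variables formula applies. Parameters mapped outside the open square contribute
    nothing since [phi] vanishes there. *)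
Lemma edge_measure_integral (phi : R * R -> R) (M : R) :
  measurable_fun setT (phi : mR * mR -> mR) ->
  (forall z, square° z -> `|phi z| <= M) -> (forall z, ~ square° z -> phi z = 0) ->
  \int[edge_measure]_(z in square°) phi z = line_integral phi a b.
Proof.
move=> mphi bphi phi0.
pose m01 : measurable (`[0%R, 1%R]%classic : set mR) := measurable_itv `[0%R, 1%R].
pose nu := mrestr mu m01.
have nufin (B : set mR) : measurable B -> (nu B < +oo)%E.
  move=> mB; apply: (@le_lt_trans _ _ (mu `[0, 1])); last by rewrite lebesgue_itv01 ltry.
  by apply: le_measure; rewrite ?inE//; exact: measurableI.
have mpre : measurable (seg a b @^-1` square° : set mR).
  rewrite -[X in measurable X]setTI.
  by apply: measurable_seg => //; exact: measurable_square_interior.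
have mps : measurable_fun setT (phi \o seg a b : mR -> mR).
  exact: (measurableT_comp mphi (@measurable_seg a b)).
have ips : nu.-integrable (seg a b @^-1` square°) (EFin \o (phi \o seg a b)).
  apply: (@bounded_integrable _ _ _ _ mpre _ mps M) => //; first by move=> t /= /bphi.
  exact: nufin.
rewrite /line_integral /Rintegral; congr fine.
have mEphi : measurable_fun setT (EFin \o phi : mR * mR -> \bar R).
  exact/measurable_EFinP.
have E := integral_pushforward (@measurable_seg a b) mEphi ips measurable_square_interior.
apply: (etrans (etrans _ E)).
  apply: eq_measure_integral; first exact: measurable_seg.
  move=> mseg A mA Asub; rewrite /pushforward/= /nu /mrestr /edge_measure /edge_trace setIC.
  by rewrite (setIidl Asub).
have nuN : nu (~` `[0, 1]) = 0%E by rewrite /nu /= /mrestr setICl measure0.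
have mN : measurable (~` `[0%R, 1%R] : set mR) by exact: measurableC.
rewrite (negligible_integral mN mpre ips nuN).
transitivity (\int[mu]_(t in (seg a b @^-1` square°) `\` ~` `[0%R, 1%R])
  (phi (seg a b t))%:E)%E.
  apply: eq_measure_integral => A mA Asub.
  rewrite /= /nu /mrestr setIidl// => t /Asub[_]; exact: contrapT.
rewrite setDE setCK setIC integral_mkcondr; apply: eq_integral => t _.
rewrite patchE; case: ifPn => //; rewrite notin_setE => out.
by rewrite phi0.
Qed.

End EdgeMeasure.

(** * Normals and the curvature distribution *)

Section Row3.
Context {R : realType}.
Implicit Types (m n : 'rV[R]_3).
Let i1 : 'I_3 := lift ord0 ord0.
Let i2 : 'I_3 := lift ord0 (lift ord0 ord0).

Lemma inord2E : inord 2 = i2.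
Proof. by apply: val_inj; rewrite /= inordK. Qed.

Lemma dot3E m n : dot m n = m 0 ord0 * n 0 ord0 + m 0 i1 * n 0 i1 + m 0 i2 * n 0 i2.
Proof. by rewrite /dot !big_ord_recl big_ord0 addr0 addrA. Qed.

Lemma row3P m n : m 0 ord0 = n 0 ord0 -> m 0 i1 = n 0 i1 -> m 0 i2 = n 0 i2 -> m = n.
Proof.
move=> e0 e1 e2; apply/rowP => j.
by case: (unliftP ord0 j) => [j' ->|->//]; case: (unliftP ord0 j') => [j'' ->|->//];
  rewrite (ord1 j'').
Qed.

Definition upward_normal (al be : R) : 'rV[R]_3 :=
  (Num.sqrt (1 + (al ^+ 2 + be ^+ 2)))^-1 *: \row_(j < 3) [:: - al; - be; 1]`_j.

Lemma upward_normal_gt0 (al be : R) : 0 < 1 + (al ^+ 2 + be ^+ 2).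
Proof. by rewrite ltr_pwDl// addr_ge0// sqr_ge0. Qed.

Lemma dot_upward_normal (al be : R) n : dot (upward_normal al be) n =
  (Num.sqrt (1 + (al ^+ 2 + be ^+ 2)))^-1 *
  (- al * n 0 ord0 - be * n 0 i1 + n 0 i2).
Proof. by rewrite dot3E /upward_normal !mxE/=; ring. Qed.

Lemma normal_norm (k al be : R) : 0 < k ->
  k ^+ 2 * (1 + (al ^+ 2 + be ^+ 2)) = 1 ->
  k = (Num.sqrt (1 + (al ^+ 2 + be ^+ 2)))^-1.
Proof.
move=> k0 e.
have := upward_normal_gt0 al be; set s := 1 + _ in e * => s0.
have sq : Num.sqrt s = k^-1.
  have k0' : k != 0 by rewrite gt_eqF.
  rewrite (_ : s = k^-1 ^+ 2); last by rewrite -[s](mulKf (expf_neq0 2 k0')) e mulr1 exprVn.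
  by rewrite sqrtr_sqr ger0_norm// invr_ge0 ltW.
by rewrite sq invrK.
Qed.

Section FaceNormal.
Context {V : finType}.
Variables (p : V -> R * R) (u : R * R -> R) (a b c : V) (al be ga : R).
Hypotheses (ab : a != b) (bc : b != c) (ca : c != a).
Hypothesis abc : cross (p a) (p b) (p c) != 0.
Hypothesis uE : forall v, v \in [set a; b; c]%SET ->
  u (p v) = al * (p v).1 + be * (p v).2 + ga.

Lemma upward_normalP : is_upward_normal p u [set a; b; c]%SET (upward_normal al be).
Proof.
have s0 := upward_normal_gt0 al be; split.
- rewrite /norm2 dot_upward_normal /upward_normal !mxE/=.
  set s := 1 + _ in s0 *.
  have sq : Num.sqrt s * Num.sqrt s = s by rewrite -expr2 sqr_sqrtr// ltW.
  have q0 : Num.sqrt s != 0 by rewrite gt_eqF// sqrtr_gt0.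
  rewrite [X in Num.sqrt X = _](_ : _ = (1 + (al ^+ 2 + be ^+ 2)) / (Num.sqrt s * Num.sqrt s)).
    by rewrite sq -/s divff ?sqrtr1 ?(gt_eqF s0).
  by field.
- move=> v w vf wf; rewrite dot_upward_normal /graph_vertex !mxE/=.
  by rewrite !uE//; ring.
- rewrite inord2E /upward_normal !mxE/= mulr1 invr_gt0 sqrtr_gt0.
  exact: s0.
Qed.

(** Orthogonality to two edges of the graph determines the direction because [cross] is the
    determinant of the resulting system; unit length and the positive third component then fix the
    vector. *)
Lemma face_normalE : face_normal p u [set a; b; c]%SET = upward_normal al be.
Proof.
have [n1 orth npos] : is_upward_normal p u [set a; b; c]%SET
    (face_normal p u [set a; b; c]%SET).
  apply: (@getPex _ [set n | is_upward_normal p u [set a; b; c]%SET n]).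
  by exists (upward_normal al be); exact: upward_normalP.
set n := face_normal _ _ _ in n1 orth npos *.
rewrite inord2E in npos.
have aS : a \in [set a; b; c]%SET by rewrite !inE eqxx.
have bS : b \in [set a; b; c]%SET by rewrite !inE eqxx orbT.
have cS : c \in [set a; b; c]%SET by rewrite !inE eqxx !orbT.
have := orth b a bS aS; have := orth c a cS aS.
rewrite !dot3E /graph_vertex !mxE/= !uE// => e2 e1.
(* The deviations from the expected direction solve a homogeneous linear system; Cramer's rule gives
   0 for both. *)
pose x := n 0 ord0 + al * n 0 i2; pose y := n 0 i1 + be * n 0 i2.
have f1 : x * ((p b).1 - (p a).1) + y * ((p b).2 - (p a).2) = 0.
  by rewrite -[RHS]e1 /x /y; ring.
have f2 : x * ((p c).1 - (p a).1) + y * ((p c).2 - (p a).2) = 0.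
  by rewrite -[RHS]e2 /x /y; ring.
have x0 : x = 0.
  apply: (mulIf abc); rewrite mul0r.
  transitivity (((p c).2 - (p a).2) * (x * ((p b).1 - (p a).1) + y * ((p b).2 - (p a).2))
    - ((p b).2 - (p a).2) * (x * ((p c).1 - (p a).1) + y * ((p c).2 - (p a).2))).
    by rewrite /cross; ring.
  by rewrite f1 f2; ring.
have y0 : y = 0.
  apply: (mulIf abc); rewrite mul0r.
  transitivity (((p b).1 - (p a).1) * (x * ((p c).1 - (p a).1) + y * ((p c).2 - (p a).2))
   - ((p c).1 - (p a).1) * (x * ((p b).1 - (p a).1) + y * ((p b).2 - (p a).2))).
    by rewrite /cross; ring.
  by rewrite f1 f2; ring.
have E0 : n 0 ord0 = - al * n 0 i2 by move: x0; rewrite /x; lra.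
have E1 : n 0 i1 = - be * n 0 i2 by move: y0; rewrite /y; lra.
have k : n 0 i2 = (Num.sqrt (1 + (al ^+ 2 + be ^+ 2)))^-1.
  apply: normal_norm => //.
  have : dot n n = 1.
    have d0 : 0 <= dot n n by rewrite /dot sumr_ge0// => i _; rewrite -expr2 sqr_ge0.
    by rewrite -[LHS]sqr_sqrtr// -/(norm2 n) n1 expr1n.
  by rewrite dot3E E0 E1 => e; rewrite -[RHS]e; ring.
apply: row3P; rewrite /upward_normal !mxE/= -k.
- by rewrite E0; ring.
- by rewrite E1; ring.
- by rewrite mulr1.
Qed.

End FaceNormal.

Lemma affine_partial (u : R * R -> R) (z : R * R) (al be ga : R) :
  (\forall z' \near z, u z' = al * z'.1 + be * z'.2 + ga) ->
  partial1 u z = al /\ partial2 u z = be.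
Proof.
move=> ue; pose L (z' : R * R) := al * z'.1 + be * z'.2 + ga.
have E v : 'D_v u z = 'D_v L z by apply: near_eq_derive.
have D v : 'D_v L z = al * v.1 + be * v.2.
  apply: cvg_lim => //; apply: cvg_near_cst; near=> h.
  have h0 : h != 0 by near: h; exact: nbhs_dnbhs_neq.
  rewrite /L /shift/= /GRing.scale/=; field.
  exact: h0.
by rewrite /partial1 /partial2 !E !D /=; split; ring.
Unshelve. all: by end_near. Qed.

Lemma affine_unit_normal (u : R * R -> R) (z : R * R) (al be ga : R) :
  (\forall z' \near z, u z' = al * z'.1 + be * z'.2 + ga) ->
  unit_normal u z = upward_normal al be.
Proof.
by move=> /affine_partial[e1 e2]; rewrite /unit_normal /area_density e1 e2.
Qed.

End Row3.

Section RintegralSum.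
Context d (T : measurableType d) (R : realType) (mu : {measure set T -> \bar R}).

Lemma integrable_sumr (I : Type) (r : seq I) (A : set T) (f : I -> T -> R) :
  measurable A -> (forall i, mu.-integrable A (EFin \o f i)) ->
  mu.-integrable A (EFin \o (fun x => \sum_(i <- r) f i x)).
Proof.
move=> mA fi; elim: r => [|i r ih].
  rewrite (_ : EFin \o _ = cst 0%E); first exact: integrable0.
  by apply/funext => x; rewrite /= big_nil.
rewrite (_ : (fun x => _) = (fun x => f i x + \sum_(i <- r) f i x)).
  exact: integrable_addr.
by apply/funext => x; rewrite big_cons.
Qed.

Lemma Rintegral_sum (I : Type) (r : seq I) (A : set T) (f : I -> T -> R) :
  measurable A -> (forall i, mu.-integrable A (EFin \o f i)) ->
  \int[mu]_(x in A) (\sum_(i <- r) f i x) = \sum_(i <- r) \int[mu]_(x in A) f i x.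
Proof.
move=> mA fi; elim: r => [|i r ih].
  by under eq_Rintegral do rewrite big_nil; rewrite Rintegral_cst// mul0r big_nil.
under eq_Rintegral do rewrite big_cons.
by rewrite RintegralD// ?ih ?big_cons//; exact: integrable_sumr.
Qed.

End RintegralSum.

(** * The curvature distribution as a sum over edges *)

Section Curvature.
Context {R : realType} {V : finType}.
Variables (p : V -> R * R) (D : {set {set V}}).
Hypothesis hD : triangulation p D square.
Implicit Types (e f g : {set V}) (a b c v w x : V).
Notation mR := (measurableTypeR R).

Definition face_triangle f : set (R * R) :=
  if enum f is [:: a; b; c] then open_triangle (p a) (p b) (p c) else set0.

Lemma face_enum f : f \in D -> exists a b c,
  [/\ enum f = [:: a; b; c], a != b, b != c, c != a & f = [set a; b; c]%SET] /\
  cross (p a) (p b) (p c) != 0.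
Proof.
move=> fD; have := face_card hD fD; rewrite cardE.
case E: (enum f) => [|a [|b [|c []]]]//= _; exists a, b, c.
have := enum_uniq (mem f); rewrite E /= !inE !negb_or => /and3P[/andP[ab ac] bc _].
have fE : f = [set a; b; c]%SET.
  by apply/finset.setP => x; rewrite -mem_enum E !inE orbA.
have ca : c != a by rewrite eq_sym.
have ind := face_indep hD fD; rewrite fE in ind.
by split; [split|exact: indep_cross].
Qed.

(* All vertices of [e] contribute 0 to the sum, so this is the side of the
   oriented edge [e] on which the remaining vertex of [f] lies. *)
Definition side f e : R :=
  Num.sg (\sum_(x in f) cross (edge_ends p e).1 (edge_ends p e).2 (p x)).

Lemma sum_in3 (M : nmodType) (F : V -> M) a b c : a != b -> b != c -> c != a ->
  \sum_(x in [set a; b; c]%SET) F x = F a + F b + F c.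
Proof.
move=> ab bc ca; rewrite big_mkcond (sum_supp3 ab bc ca); last first.
  by move=> v /negbTE ->.
by rewrite !inE !eqxx !orbT.
Qed.

Lemma edge_ends2 v w : v != w -> edge_ends p [set v; w]%SET = (p v, p w) \/
  edge_ends p [set v; w]%SET = (p w, p v).
Proof.
move=> vw; have c2 : #|[set v; w]%SET| = 2%N by rewrite cards2 vw.
move: c2; rewrite cardE /edge_ends; case E: (enum _) => [|x [|y []]]//= _.
have := enum_uniq (mem [set v; w]%SET); rewrite E /= inE andbT => xy.
have xin : x \in [set v; w]%SET by rewrite -mem_enum E !inE eqxx.
have yin : y \in [set v; w]%SET by rewrite -mem_enum E !inE eqxx orbT.
move: xin yin xy; rewrite !inE => /orP[] /eqP -> /orP[] /eqP ->; rewrite ?eqxx//.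
  by left.
by right.
Qed.

Lemma cross12 (a b : R * R) : cross a b b = 0.
Proof. by rewrite /cross; ring. Qed.

Lemma cross13 (a b : R * R) : cross a b a = 0.
Proof. by rewrite /cross; ring. Qed.

(** If [edge_ends] lists the ends in the other order, [side] and the antisymmetric [D1] both change
    sign while [LI] does not. *)
Lemma side_term (D1 LI : R * R -> R * R -> R) v w x :
  (forall s t, D1 t s = - D1 s t) -> (forall s t, LI t s = LI s t) ->
  v != w -> w != x -> x != v ->
  side [set v; w; x]%SET [set v; w]%SET *
    (D1 (edge_ends p [set v; w]%SET).1 (edge_ends p [set v; w]%SET).2 *
     LI (edge_ends p [set v; w]%SET).1 (edge_ends p [set v; w]%SET).2) =
  Num.sg (cross (p v) (p w) (p x)) * (D1 (p v) (p w) * LI (p v) (p w)).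
Proof.
move=> D1C LIC vw wx xv; rewrite /side sum_in3//.
case: (edge_ends2 vw) => -> /=; first by rewrite cross13 cross12 !add0r.
by rewrite cross12 cross13 !add0r crossC sgrN D1C LIC; ring.
Qed.

Lemma edges_of_face a b c : a != b -> b != c -> c != a -> [set a; b; c]%SET \in D ->
  [set e in edges D | e \subset [set a; b; c]]%SET =
  [set [set a; b]; [set b; c]; [set c; a]]%SET.
Proof.
move=> ab bc ca fD; apply/finset.setP => e; rewrite !inE; apply/idP/idP.
  move=> /andP[/andP[c2 _] ef]; have /cards2P[v [w [vw eE]]] := c2.
  have vf : v \in [set a; b; c]%SET by apply: (fintype.subsetP ef); rewrite eE !inE eqxx.
  have wf : w \in [set a; b; c]%SET by apply: (fintype.subsetP ef); rewrite eE !inE eqxx orbT.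
  move: vf wf vw; rewrite !inE eE => /orP[/orP[]|] /eqP -> /orP[/orP[]|] /eqP ->;
    rewrite ?eqxx// => _.
  - by rewrite [[set a; c]%SET]finset.setUC eqxx !orbT.
  - by rewrite [[set b; a]%SET]finset.setUC eqxx.
  - by rewrite orbT.
  - by rewrite orbT.
  - by rewrite [[set c; b]%SET]finset.setUC eqxx !orbT.
have sub v w : v \in [set a; b; c]%SET -> w \in [set a; b; c]%SET -> v != w ->
    (#|[set v; w]%SET| == 2%N) && [exists f in D, [set v; w]%SET \subset f] &&
    ([set v; w]%SET \subset [set a; b; c]%SET).
  move=> vf wf vw; have s : [set v; w]%SET \subset [set a; b; c]%SET.
    by apply/fintype.subsetP => x; rewrite !inE => /orP[] /eqP ->; rewrite -?in_setU1;
      [move: vf|move: wf]; rewrite !inE.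
  by rewrite cards2 vw s andbT /=; apply/existsP; exists [set a; b; c]%SET; rewrite fD.
by move=> /orP[/orP[]|] /eqP ->; apply: sub; rewrite ?inE ?eqxx ?orbT.
Qed.

Lemma sum_edges_of_face (F : {set V} -> R) a b c :
  a != b -> b != c -> c != a -> [set a; b; c]%SET \in D ->
  \sum_(e in edges D | e \subset [set a; b; c]%SET) F e =
  F [set a; b]%SET + F [set b; c]%SET + F [set c; a]%SET.
Proof.
move=> ab bc ca fD.
have sc (s t : {set V}) x : x \in s -> x \notin t -> s != t.
  by move=> xs xt; apply/eqP => st; move: xt; rewrite -st xs.
rewrite (eq_bigl (fun e =>
  e \in [set e in edges D | e \subset [set a; b; c]]%SET)); last first.
  by move=> e; rewrite [RHS]inE.
rewrite edges_of_face// big_mkcond.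
rewrite (@sum_supp3 _ _ _ [set a; b]%SET [set b; c]%SET [set c; a]%SET).
- by rewrite !inE !eqxx !orbT.
- by apply: (sc _ _ a); rewrite !inE ?eqxx// negb_or ab eq_sym.
- by apply: (sc _ _ b); rewrite !inE ?eqxx// negb_or bc eq_sym.
- by apply: (sc _ _ c); rewrite !inE ?eqxx// negb_or ca eq_sym.
- by move=> e /negbTE ->.
Qed.

(** [D1] stands for a difference of first or of second coordinates, so one statement serves both
    Green formulas. The three edges are handled by rotating the triangle, which preserves
    [cross]. *)
Lemma sum_face_edges (D1 LI : R * R -> R * R -> R) f :
  (forall s t, D1 t s = - D1 s t) -> (forall s t, LI t s = LI s t) -> f \in D ->
  \sum_(e in edges D | e \subset f) side f e *
    (D1 (edge_ends p e).1 (edge_ends p e).2 * LI (edge_ends p e).1 (edge_ends p e).2) =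
  if enum f is [:: a; b; c] then
    Num.sg (cross (p a) (p b) (p c)) *
      (D1 (p a) (p b) * LI (p a) (p b) + D1 (p b) (p c) * LI (p b) (p c)
       + D1 (p c) (p a) * LI (p c) (p a))
  else 0.
Proof.
move=> D1C LIC fD; have [a [b [c [[-> ab bc ca fE] d0]]]] := face_enum fD.
rewrite fE in fD *; rewrite sum_edges_of_face//.
have r1 : [set a; b; c]%SET = [set b; c; a]%SET.
  by rewrite -finset.setUA finset.setUC.
have r2 : [set a; b; c]%SET = [set c; a; b]%SET.
  by rewrite finset.setUC finset.setUA.
have h2 := side_term D1C LIC bc ca ab; rewrite -r1 (cross_rot (p a)) in h2.
have h3 := side_term D1C LIC ca ab bc; rewrite -r2 -(cross_rot (p c)) in h3.
by rewrite (side_term D1C LIC ab bc ca) h2 h3; ring.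
Qed.

Variable phi : R * R -> R.
Hypothesis tphi : test_function square° phi.

Definition edge_integral e : R :=
  line_integral phi (edge_ends p e).1 (edge_ends p e).2.

Let LIC (s t : R * R) : line_integral phi t s = line_integral phi s t.
Proof. by apply: line_integralC; exact: test_continuous tphi. Qed.

Lemma face_green1 f : f \in D ->
  \int[lebesgue2]_(z in square) (\1_(face_triangle f) z * partial1 phi z) =
  \sum_(e in edges D | e \subset f) side f e *
    (((edge_ends p e).2.2 - (edge_ends p e).1.2) * edge_integral e).
Proof.
move=> fD; rewrite (sum_face_edges (D1 := fun s t => t.2 - s.2) _ LIC)//; last first.
  by move=> a b; rewrite opprB.
have [a [b [c [[E ab bc ca fE] d0]]]] := face_enum fD.
have sq x : x \in [set a; b; c]%SET -> square (p x).
  by rewrite -fE => xf; exact: (vertex_square hD fD xf).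
by rewrite /face_triangle E green1//; apply: sq; rewrite !inE ?eqxx ?orbT.
Qed.

Lemma face_green2 f : f \in D ->
  \int[lebesgue2]_(z in square) (\1_(face_triangle f) z * partial2 phi z) =
  - \sum_(e in edges D | e \subset f) side f e *
    (((edge_ends p e).2.1 - (edge_ends p e).1.1) * edge_integral e).
Proof.
move=> fD; rewrite (sum_face_edges (D1 := fun s t => t.1 - s.1) _ LIC)//; last first.
  by move=> a b; rewrite opprB.
have [a [b [c [[E ab bc ca fE] d0]]]] := face_enum fD.
have sq x : x \in [set a; b; c]%SET -> square (p x).
  by rewrite -fE => xf; exact: (vertex_square hD fD xf).
by rewrite /face_triangle E -mulNr green2//; apply: sq; rewrite !inE ?eqxx ?orbT.
Qed.

Lemma measurable_face_triangle f : measurable (face_triangle f : set (mR * mR)).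
Proof.
rewrite /face_triangle; case: (enum f) => [|a [|b [|c []]]] //.
exact: measurable_open_triangle.
Qed.

(* Whole lines rather than edges: the set is only needed to be null. *)
Definition skeleton_lines : set (mR * mR) :=
  \big[setU/set0]_(vw : V * V | p vw.1 != p vw.2) [set z | cross (p vw.1) (p vw.2) z = 0].

Lemma skeleton_lines_null :
  measurable skeleton_lines /\ lebesgue2 skeleton_lines = 0%E.
Proof.
rewrite /skeleton_lines.
apply: (big_ind (fun A : set (mR * mR) => measurable A /\ lebesgue2 A = 0%E))
  => [|A B [mA A0] [mB B0]|vw vw_neq].
- by split => //; exact: measure0.
- split; first exact: measurableU.
  by rewrite measureU0.
- by split; [exact: measurable_line|exact: line_null].
Qed.

Lemma skeleton_linesP v w z : p v != p w -> ~ skeleton_lines z ->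
  cross (p v) (p w) z != 0.
Proof.
move=> vw nz; apply/eqP => c0; apply: nz; rewrite /skeleton_lines (bigD1 (v, w))//=.
by left.
Qed.

Lemma face_triangle_hull f : f \in D -> face_triangle f `<=` hull p f.
Proof.
move=> fD; have [a [b [c [[E ab bc ca fE] d0]]]] := face_enum fD.
rewrite /face_triangle E fE => z [h1 h2 h3].
by apply/hullE3 => //; split; exact: ltW.
Qed.

Lemma face_triangle_cover z : square z -> ~ skeleton_lines z ->
  exists2 f, f \in D & face_triangle f z.
Proof.
move=> sz nz; case: hD => _ _ cov; move: sz; rewrite -cov => -[f /= fD fz].
exists f => //; move: fz; have [a [b [c [[E ab bc ca fE] d0]]]] := face_enum fD.
rewrite /face_triangle E fE => /(hullE3 _ ab bc ca d0)[h1 h2 h3].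
have neq (s t : R * R) : s = t ->
    cross s t (p a) = 0 /\ cross s t (p b) = 0 /\ cross s t (p c) = 0.
  by move=> ->; rewrite !crossaa.
have n1 : p a != p b by apply: contra_neq d0 => /neq[_ []].
have n2 : p b != p c by apply: contra_neq d0 => /neq[]; rewrite cross_rot.
have n3 : p c != p a by apply: contra_neq d0 => /neq[_ []]; rewrite -(cross_rot (p c)).
have pos x y : p x != p y -> 0 <= cross (p x) (p y) z * cross (p a) (p b) (p c) ->
    0 < cross (p x) (p y) z * cross (p a) (p b) (p c).
  by move=> xy; rewrite le0r mulf_eq0 (negbTE d0) (negbTE (skeleton_linesP xy nz)).
by split; apply: pos.
Qed.

(** A point common to two different faces lies in the hull of [f :&: g], which misses some vertex
    [x] of [f]; so it is on the side of [f] opposite to [x], where one of the strict inequalities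
    fails. *)
Lemma face_triangle_inj f g z : f \in D -> g \in D ->
  face_triangle f z -> face_triangle g z -> f = g.
Proof.
move=> fD gD fz gz; have [//|fg] := eqVneq f g; exfalso.
have hfg : hull p (f :&: g) z.
  case: hD => _ /(_ f g fD gD) <- _.
  by split; exact: face_triangle_hull.
have /fintype.subsetPn[x xf xg] : ~~ (f \subset g).
  apply: contra fg => sub; rewrite eqEcard sub.
  by rewrite (face_card hD fD) (face_card hD gD).
move: fz; have [a [b [c [[E ab bc ca fE] d0]]]] := face_enum fD.
rewrite /face_triangle E => -[h1 h2 h3].
have key v w : v != w -> (forall y, y \in f -> y != x -> y \in [set v; w]%SET) ->
    cross (p v) (p w) z = 0.
  move=> vw sub; have : hull p [set v; w]%SET z.
    apply: hull_subset hfg; apply/fintype.subsetP => y; rewrite finset.in_setI => /andP[yf yg].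
    by apply: sub => //; apply: contraNneq xg => <-.
  by move=> /(hullE2 _ _ vw)[t _ ->]; rewrite cross_seg cross12 cross13; ring.
have nz s t : 0 < cross s t z * cross (p a) (p b) (p c) -> cross s t z <> 0.
  by move=> + s0; rewrite s0 mul0r ltxx.
move: xf; rewrite fE !inE => /orP[/orP[]|] /eqP xE; rewrite xE in key.
- apply: (nz _ _ h2); apply: key => // y; rewrite fE !inE => /orP[/orP[]|] -> //;
    rewrite ?orbT//.
- apply: (nz _ _ h3); apply: key => // y; rewrite fE !inE => /orP[/orP[]|] -> //;
    rewrite ?orbT//.
- apply: (nz _ _ h1); apply: key => // y; rewrite fE !inE => /orP[/orP[]|] -> //;
    rewrite ?orbT//.
Qed.

(** Both parts of [m_u] have this form: the field [(k1, k2)] is constant on each open triangle, and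
    [F] may be arbitrary elsewhere. Off the skeleton lines exactly one face contributes, Green's
    formula is applied face by face, and the double sum is reordered by edges. *)
Lemma faces_distribution (F : R * R -> R) (k1 k2 : {set V} -> R) :
  (forall f z, f \in D -> face_triangle f z ->
     F z = k1 f * partial1 phi z + k2 f * partial2 phi z) ->
  - (\int[lebesgue2]_(z in square) F z) =
  \sum_(e in edges D) \sum_(f in faces_at D e)
    side f e * (k2 f * ((edge_ends p e).2.1 - (edge_ends p e).1.1)
                - k1 f * ((edge_ends p e).2.2 - (edge_ends p e).1.2)) * edge_integral e.
Proof.
move=> FE; have [mN N0] := skeleton_lines_null.
have c1 := test_partial1_continuous tphi; have c2 := test_partial2_continuous tphi.
pose G f z := k1 f * (\1_(face_triangle f) z * partial1 phi z) +
  k2 f * (\1_(face_triangle f) z * partial2 phi z).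
have i1 f := indic_mul_integrable (measurable_face_triangle f) c1.
have i2 f := indic_mul_integrable (measurable_face_triangle f) c2.
have mS := @measurable_square R.
have iG f : lebesgue2.-integrable square (EFin \o G f).
  by apply: integrable_addr => //; exact: integrable_mulrl.
have -> : \int[lebesgue2]_(z in square) F z =
    \int[lebesgue2]_(z in square) (\sum_(f <- enum D) G f z).
  rewrite /Rintegral; congr fine.
  apply: (eq_integral_off_null mN N0) => z sz nz; congr EFin.
  have [f fD fz] := face_triangle_cover sz nz.
  rewrite (FE f)// (bigD1_seq f) ?mem_enum ?enum_uniq//=.
  rewrite big_seq_cond big1 ?addr0.
    by rewrite /G indicE mem_set// !mul1r.
  move=> g; rewrite mem_enum => /andP[gD gf]; rewrite /G indicE memNset ?mul0r ?mulr0 ?addr0//.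
  by move=> gz; move: gf; rewrite (face_triangle_inj gD fD gz fz) eqxx.
rewrite Rintegral_sum// big_enum/=.
transitivity (\sum_(f in D) \sum_(e in edges D | e \subset f)
   side f e * (k2 f * ((edge_ends p e).2.1 - (edge_ends p e).1.1)
                - k1 f * ((edge_ends p e).2.2 - (edge_ends p e).1.2)) * edge_integral e).
  rewrite -sumrN; apply: eq_bigr => f fD.
  rewrite /G RintegralD//; [|exact: integrable_mulrl|exact: integrable_mulrl].
  rewrite !RintegralZl// face_green1// face_green2// mulrN opprD opprK.
  rewrite !mulr_sumr -sumrN -big_split/=; apply: eq_bigr => e _; ring.
rewrite (exchange_big_dep (mem (edges D)))/=; last by move=> f e _ /andP[].
apply: eq_bigr => e eD; apply: eq_bigl => f.
by rewrite eD /= [RHS]inE.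
Qed.

End Curvature.

(** * The energy of an edge *)

Section Vectors.
Context {R : realType}.

Lemma l2norm_matrix_rank1 p q (a : 'I_p -> R) (b : 'I_q -> R) :
  l2norm_matrix (fun j k => a j * b k) =
  Num.sqrt (\sum_j a j ^+ 2) * Num.sqrt (\sum_k b k ^+ 2).
Proof.
rewrite /l2norm_matrix -sqrtrM; last by apply: sumr_ge0 => j _; exact: sqr_ge0.
congr Num.sqrt; rewrite mulr_suml; apply: eq_bigr => j _.
by rewrite mulr_sumr; apply: eq_bigr => k _; rewrite exprMn.
Qed.

(** The duplication formula gives 2 - 2 cos t = (2 sin (t / 2)) ^ 2, and the sine is nonnegative
    because [acos] takes values between 0 and [pi]. *)
Lemma half_angle (d : R) : -1 <= d <= 1 ->
  2 * sin (acos d / 2) = Num.sqrt (2 - 2 * d).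
Proof.
move=> d1; have [/andP[t0 tpi] cd] := acos_def d1.
have s0 : 0 <= sin (acos d / 2).
  apply: sin_ge0_pi; rewrite divr_ge0//= ler_pdivrMr//.
  by have := pi_ge0 R; lra.
have e : d = cos (acos d / 2) ^+ 2 *+ 2 - 1.
  by rewrite -cos_mulr2n (_ : _ *+ 2 = acos d) ?cd// mulr2n; field.
move: (acos d / 2) s0 e => x s0 ->.
rewrite (_ : 2 - _ = (2 * sin x) ^+ 2); last first.
  have -> : cos x ^+ 2 = 1 - sin x ^+ 2 by have := cos2Dsin2 x; lra.
  by ring.
by rewrite sqrtr_sqr ger0_norm// mulr_ge0.
Qed.

Lemma unit_vectors_dist n (a b : 'rV[R]_n) : norm2 a = 1 -> norm2 b = 1 ->
  2 * sin (acos (dot a b) / 2) = Num.sqrt (\sum_i (a 0 i - b 0 i) ^+ 2).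
Proof.
move=> a1 b1.
have sq (c : 'rV[R]_n) : norm2 c = 1 -> \sum_i c 0 i ^+ 2 = 1.
  move=> c1; have c0 : 0 <= \sum_i c 0 i ^+ 2 by apply: sumr_ge0 => i _; exact: sqr_ge0.
  have E : \sum_i c 0 i ^+ 2 = dot c c by apply: eq_bigr => i _; rewrite expr2.
  by rewrite -[LHS]sqr_sqrtr// E -/(norm2 c) c1 expr1n.
(* Used with both signs: nonnegativity for [s = 1] and [s = -1] yields the bounds on the dot product
   that [acos] needs, and [s = -1] is also the squared distance. *)
have E (s : R) : s ^+ 2 = 1 ->
    \sum_i (a 0 i + s * b 0 i) ^+ 2 = 2 + 2 * s * dot a b.
  move=> s1; transitivity (\sum_i a 0 i ^+ 2 + 2 * s * dot a b + s ^+ 2 * \sum_i b 0 i ^+ 2).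
    rewrite /dot !mulr_sumr -!big_split/=; apply: eq_bigr => i _; ring.
  by rewrite s1 (sq a)// (sq b)//; ring.
have p1 : 0 <= \sum_i (a 0 i + 1 * b 0 i) ^+ 2 by apply: sumr_ge0 => i _; exact: sqr_ge0.
have p2 : 0 <= \sum_i (a 0 i + -1 * b 0 i) ^+ 2 by apply: sumr_ge0 => i _; exact: sqr_ge0.
rewrite E ?expr1n// in p1; have Em := E (-1); rewrite Em ?sqrrN ?expr1n// in p2.
rewrite half_angle; last by lra.
congr Num.sqrt; transitivity (\sum_i (a 0 i + -1 * b 0 i) ^+ 2).
  by rewrite Em ?sqrrN ?expr1n//; ring.
by apply: eq_bigr => i _; rewrite mulN1r.
Qed.

End Vectors.

Section Assembly.
Context {R : realType} {V : finType}.
Variables (p : V -> R * R) (D : {set {set V}}) (u : R * R -> R).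
Hypothesis hD : triangulation p D square.
Hypothesis haff : forall f : {set V}, f \in D -> affine_on u (hull p f).
Implicit Types (e f g : {set V}) (v w x y : V).
Notation mR := (measurableTypeR R).

(** With two faces the sides are opposite, so this is the difference of their normals up to sign;
    with a single face it is that normal up to sign. *)
Definition jump e (j : 'I_3) : R :=
  \sum_(f in faces_at D e) side p f e * face_normal p u f 0 j.

Definition graph_edge e (k : 'I_3) : R :=
  [:: - ((edge_ends p e).2.2 - (edge_ends p e).1.2);
      (edge_ends p e).2.1 - (edge_ends p e).1.1;
      u (edge_ends p e).2 - u (edge_ends p e).1]`_k.

Lemma slopes : exists al be ga : {set V} -> R, forall f z, f \in D -> hull p f z ->
  u z = al f * z.1 + be f * z.2 + ga f.
Proof.
have : forall f, exists abc : R * R * R, f \in D -> forall z, hull p f z ->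
    u z = abc.1.1 * z.1 + abc.1.2 * z.2 + abc.2.
  move=> f; have [fD|nfD] := boolP (f \in D); last by exists 0.
  by have [a [b [c abc]]] := haff fD; exists (a, b, c).
move=> /choice[F hF]; exists (fun f => (F f).1.1), (fun f => (F f).1.2), (fun f => (F f).2).
by move=> f z fD fz; exact: hF.
Qed.

Lemma face_normal_unit f : f \in D -> norm2 (face_normal p u f) = 1.
Proof.
move=> fD; have [al [be [ga uE]]] := slopes.
have [a [b [c [[E ab bc ca fE] d0]]]] := face_enum hD fD.
have uv v : v \in [set a; b; c]%SET -> u (p v) = al f * (p v).1 + be f * (p v).2 + ga f.
  by rewrite -fE => vf; apply: uE => //; exact: hull_vertex.
have [n1 _ _] := upward_normalP uv.
by rewrite [X in face_normal p u X]fE (face_normalE d0 uv).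
Qed.

(** The three values of [k] are [faces_distribution] with constant fields [(n, 0)], [(0, n)] and
    [(- n * be, n * al)], where [n] is the j-th component of the normal of the face and [al], [be]
    are its slopes. *)
Lemma curvature_edges phi j k : test_function square° phi ->
  curvature_dist u j k phi =
  \sum_(e in edges D) jump e j * graph_edge e k * edge_integral p phi e.
Proof.
move=> tphi; have [al [be [ga uE]]] := slopes.
have loc f z : f \in D -> face_triangle p f z ->
    \forall z' \near z, u z' = al f * z'.1 + be f * z'.2 + ga f.
  move=> fD fz; have : nbhs z (face_triangle p f).
    apply: open_nbhs_nbhs; split => //; have [a [b [c [[E _ _ _ _] _]]]] := face_enum hD fD.
    by rewrite /face_triangle E; exact: open_open_triangle.
  by apply: filterS => z' /(face_triangle_hull hD fD); exact: uE.
have nu f z : f \in D -> face_triangle p f z -> unit_normal u z = face_normal p u f.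
  move=> fD fz; have [a [b [c [[E ab bc ca fE] d0]]]] := face_enum hD fD.
  have uv v : v \in [set a; b; c]%SET -> u (p v) = al f * (p v).1 + be f * (p v).2 + ga f.
    by rewrite -fE => vf; apply: uE => //; exact: hull_vertex.
  rewrite [X in face_normal p u X]fE (face_normalE d0 uv).
  exact: affine_unit_normal (loc f z fD fz).
(* The derivative along the edge, computed from any adjacent face, is the difference of the values
   of [u] at the ends. This lets the third component factor out of the sum over faces. *)
have slope e f : e \in edges D -> f \in faces_at D e ->
    al f * ((edge_ends p e).2.1 - (edge_ends p e).1.1) +
    be f * ((edge_ends p e).2.2 - (edge_ends p e).1.2) =
    u (edge_ends p e).2 - u (edge_ends p e).1.
  move=> eD /faces_atP[fD ef]; have [v [w [_ [vw eE En _]]]] := edgeP eD.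
  have vf : v \in f by apply: (fintype.subsetP ef); rewrite eE !inE eqxx.
  have wf : w \in f by apply: (fintype.subsetP ef); rewrite eE !inE eqxx orbT.
  rewrite /edge_ends En /= (uE f (p w))//; last exact: hull_vertex.
  by rewrite (uE f (p v))//; [ring|exact: hull_vertex].
rewrite /curvature_dist; case: k => -[|[|[|//]]] k3 /=.
- rewrite /dist_partial1 (@faces_distribution _ _ _ _ hD _ tphi _
    (fun f => face_normal p u f 0 j) (fun=> 0)); last first.
    by move=> f z fD fz; rewrite (nu f)// mul0r addr0.
  apply: eq_bigr => e eD; rewrite /jump /graph_edge/= -mulrA mulr_suml.
  apply: eq_bigr => f _; ring.
- rewrite /dist_partial2 (@faces_distribution _ _ _ _ hD _ tphi _
    (fun=> 0) (fun f => face_normal p u f 0 j)); last first.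
    by move=> f z fD fz; rewrite (nu f)// mul0r add0r.
  apply: eq_bigr => e eD; rewrite /jump /graph_edge/= -mulrA mulr_suml.
  apply: eq_bigr => f _; ring.
- rewrite /dist_div (@faces_distribution _ _ _ _ hD _ tphi _
    (fun f => - (face_normal p u f 0 j * be f))
    (fun f => face_normal p u f 0 j * al f)); last first.
    move=> f z fD fz; rewrite /sigma/= (nu f)//.
    by have [-> ->] := affine_partial (loc f z fD fz).
  apply: eq_bigr => e eD; rewrite /jump /graph_edge/= -mulrA mulr_suml.
  apply: eq_bigr => f ef; rewrite -(slope e f eD ef); ring.
Qed.

End Assembly.

Section Energy.
Context {R : realType} {V : finType}.
Variables (p : V -> R * R) (D : {set {set V}}) (u : R * R -> R).
Hypothesis hD : triangulation p D square.
Hypothesis haff : forall f : {set V}, f \in D -> affine_on u (hull p f).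
Implicit Types (e f g : {set V}) (v w x y : V).
Notation mR := (measurableTypeR R).

(* The tangential derivative of [u] agrees on both sides of [e], so the density
   of all nine components is the jump of the normal times one vector, which up to
   a quarter turn of the plane is the edge of the graph above [e]. *)
Definition edge_weight e (j k : 'I_3) : R := jump p D u e j * graph_edge p u e k.

Definition edge_rho e : {finite_measure set (mR * mR)%type -> \bar R} :=
  edge_measure (edge_ends p e).1 (edge_ends p e).2.

Definition edge_segment e : set (mR * mR) :=
  segment (edge_ends p e).1 (edge_ends p e).2.

Definition curvature_measure :=
  comb_matrix edge_weight edge_rho (enum (edges D)).

Lemma edge_data e : e \in edges D -> exists v w,
  [/\ v != w, e = [set v; w]%SET, enum e = [:: v; w],
      edge_ends p e = (p v, p w) & p v != p w].
Proof.
move=> eD; have [v [w [f [vw eE En fe]]]] := edgeP eD.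
exists v, w; split => //; first by rewrite /edge_ends En.
have /faces_atP[fD ef] := fe; rewrite eE in ef.
have [x [_ _ _ d0]] := face_split hD fD vw ef.
by apply: contra_neq d0 => ->; rewrite crossaa.
Qed.

Lemma edge_segmentE e : e \in edges D -> edge_segment e = hull p e.
Proof.
move=> eD; have [v [w [vw eE _ En _]]] := edge_data eD.
rewrite /edge_segment En [in RHS]eE; apply/seteqP; split => z.
  by move=> [t]; rewrite /= in_itv/= => t01 <-; apply/hullE2 => //; exists t.
by move=> /(hullE2 _ _ vw)[t t01 ->]; exists t; rewrite //= in_itv.
Qed.

Lemma seg_inj (a b : R * R) s t : a != b -> seg a b s = seg a b t -> s = t.
Proof.
move=> ab [e1 e2]; apply/eqP; rewrite -subr_eq0; apply: contraNT ab => st.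
apply/eqP/esym; rewrite [LHS]surjective_pairing [RHS]surjective_pairing.
congr pair; apply/eqP; rewrite -subr_eq0; apply/eqP; apply: (mulfI st).
  by rewrite mulr0 mulrBl; move: e1; lra.
by rewrite mulr0 mulrBl; move: e2; lra.
Qed.

Lemma edge_rho_carrier e : edge_rho e (~` edge_segment e) = 0%E.
Proof. by apply: edge_measure_segmentC; rewrite setICl. Qed.

Lemma edge_rho_disjoint e e' : e \in edges D -> e' \in edges D -> e != e' ->
  edge_rho e (edge_segment e') = 0%E.
Proof.
move=> eD e'D ee'; apply: edge_measure_null; first exact: measurable_segment.
have [v [w [vw eE _ En pvw]]] := edge_data eD.
move=> s t s01 t01; rewrite edge_segmentE// => hs ht.
have h r : 0 <= r <= 1 -> hull p e (seg (edge_ends p e).1 (edge_ends p e).2 r).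
  by move=> r01; rewrite -edge_segmentE//; exists r; rewrite //= in_itv.
have := edges_hullI hD eD e'D ee' (h s s01) hs (h t t01) ht.
by rewrite En; exact: seg_inj.
Qed.

Lemma curvature_total_variation (A : set (mR * mR)) : measurable A ->
  vector_total_variation curvature_measure A =
  (\sum_(e in edges D) fine (edge_rho e A) * l2norm_matrix (edge_weight e))%:E.
Proof.
move=> mA; rewrite (vector_total_variation_comb _ (H := edge_segment))//.
- by rewrite big_enum.
- exact: enum_uniq.
- by move=> e; exact: measurable_segment.
- by move=> e _; exact: edge_rho_carrier.
- by move=> e e'; rewrite !mem_enum; exact: edge_rho_disjoint.
Qed.

Lemma faces_third v w f : v != w -> f \in faces_at D [set v; w]%SET ->
  exists x, [/\ w != x, x != v & f = [set v; w; x]%SET].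
Proof.
move=> vw /faces_atP[fD ef]; have [x [wx xv fE _]] := face_split hD fD vw ef.
by exists x.
Qed.

Lemma faces_opposite v w x y : v != w ->
  [set v; w; x]%SET \in faces_at D [set v; w]%SET ->
  [set v; w; y]%SET \in faces_at D [set v; w]%SET ->
  w != x -> x != v -> w != y -> y != v -> [set v; w; x]%SET != [set v; w; y]%SET ->
  cross (p v) (p w) (p x) * cross (p v) (p w) (p y) < 0.
Proof.
move=> vw /faces_atP[fD _] /faces_atP[gD _] wx xv wy yv fg.
apply: (opposite_sides hD) => //; by apply: contra_neq fg => ->.
Qed.

(** Three faces would give three nonzero reals of pairwise opposite signs. *)
Lemma faces_at_le2 e : e \in edges D -> (#|faces_at D e| <= 2)%N.
Proof.
move=> eD; have [v [w [vw eE _ _ _]]] := edge_data eD.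
rewrite leqNgt; apply/negP; rewrite eE cardE.
case E: (enum _) => [|f [|g [|h s]]]// _.
have := enum_uniq (mem (faces_at D [set v; w]%SET)); rewrite E /= !inE !negb_or.
move=> /and4P[/and3P[fg fh _] /andP[gh _] _ _].
have mf : f \in faces_at D [set v; w]%SET by rewrite -mem_enum E !inE eqxx.
have mg : g \in faces_at D [set v; w]%SET by rewrite -mem_enum E !inE eqxx orbT.
have mh : h \in faces_at D [set v; w]%SET by rewrite -mem_enum E !inE eqxx !orbT.
have [x [wx xv fE]] := faces_third vw mf.
have [y [wy yv gE]] := faces_third vw mg.
have [z [wz zv hE]] := faces_third vw mh.
rewrite fE gE hE in mf mg mh fg fh gh.
have := faces_opposite vw mf mg wx xv wy yv fg.
have := faces_opposite vw mf mh wx xv wz zv fh.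
have := faces_opposite vw mg mh wy yv wz zv gh.
set a := cross _ _ (p x); set b := cross _ _ (p y); set c := cross _ _ (p z).
move=> bc ac ab; have : 0 < (a * b) * (a * c) by rewrite nmulr_rgt0.
rewrite (_ : _ * _ = a ^+ 2 * (b * c)); last by ring.
by rewrite ltNge mulr_ge0_le0 ?sqr_ge0// ltW.
Qed.

Lemma side_third v w x e : v != w -> w != x -> x != v ->
  edge_ends p e = (p v, p w) ->
  side p [set v; w; x]%SET e = Num.sg (cross (p v) (p w) (p x)).
Proof.
by move=> vw wx xv En; rewrite /side sum_in3// En/= cross13 cross12 !add0r.
Qed.

(** An edge with one face has nonzero weight but mass 0, so it drops out. An edge with two faces has
    mass 1 and contributes the norm of its rank-one weight: the quarter turn in [graph_edge]
    preserves the length of the graph edge, and [jump] has the norm of the difference of the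
    normals. *)
Lemma edge_energy e : e \in edges D ->
  fine (edge_rho e square°) * l2norm_matrix (edge_weight e) =
  if #|faces_at D e| == 2%N then
    edge_length p u e * (2 * sin (dihedral_angle p D u e / 2)) else 0.
Proof.
move=> eD; have mI := @measurable_square_interior R.
have [v [w [vw eE En Ends pvw]]] := edge_data eD.
have le2 := faces_at_le2 eD.
case: ifP => [/eqP c2|/negbT c2]; last first.
  have /cards1P[f fsE] : #|faces_at D e| == 1%N.
    have [_ [_ [f [_ _ _ fe]]]] := edgeP eD.
    have : (0 < #|faces_at D e|)%N by apply/card_gt0P; exists f.
    by move: le2 c2; case: #|_| => [|[|[|]]].
  have fe : f \in faces_at D e by rewrite fsE finset.in_set1.
  rewrite eE in fe fsE; have [x [wx xv fE]] := faces_third vw fe.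
  rewrite (_ : edge_rho e square° = 0%E) ?mul0r//.
  apply: edge_measure_boundary => // t t01; rewrite Ends/=.
  by apply: (edge_boundary hD vw (x := x)) => //; rewrite -fE.
have c2' := c2; rewrite cardE in c2'; rewrite /dihedral_angle.
case E: (enum _) c2' => [|f [|g []]]// _.
have mf : f \in faces_at D e by rewrite -mem_enum E !inE eqxx.
have mg : g \in faces_at D e by rewrite -mem_enum E !inE eqxx orbT.
have := enum_uniq (mem (faces_at D e)); rewrite E /= inE andbT => fg.
have fD : f \in D by case/faces_atP : mf.
have gD : g \in D by case/faces_atP : mg.
have fsE : faces_at D e = [set f; g]%SET.
  by apply/finset.setP => h; rewrite -mem_enum E !inE.
have mf' := mf; have mg' := mg; rewrite eE in mf' mg'.
have [x [wx xv fE]] := faces_third vw mf'; have [y [wy yv gE]] := faces_third vw mg'.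
have op : cross (p v) (p w) (p x) * cross (p v) (p w) (p y) < 0.
  by apply: faces_opposite => //; rewrite -?fE -?gE.
have xy : x != y by apply: contra_neq fg; rewrite fE gE => ->.
rewrite (_ : edge_rho e square° = 1%E) ?mul1r; last first.
  apply: edge_measure_full => // t t01; rewrite Ends/=.
  suff h : square° (seg (p v) (p w) t) by [].
  by apply: (edge_interior hD vw _ _ wx xv wy yv xy) => //; rewrite -?fE -?gE.
rewrite /edge_weight l2norm_matrix_rank1 mulrC; congr (_ * _).
  rewrite /edge_length En /norm2 dot3E /graph_vertex !mxE/=; congr Num.sqrt.
  by rewrite !big_ord_recl big_ord0 /graph_edge Ends/=; ring.
rewrite unit_vectors_dist; [|exact: (face_normal_unit hD haff)|exact: (face_normal_unit hD haff)].
congr Num.sqrt; apply: eq_bigr => j _; rewrite /jump fsE big_setU1 ?inE//= big_set1.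
rewrite [X in side p X e]fE [X in _ + side p X e * _]gE !side_third//.
set a := cross _ _ (p x) in op *; set b := cross _ _ (p y) in op *.
have a0 : a != 0 by apply: contraTneq op => ->; rewrite mul0r ltxx.
(* The sign of [a] tells which face lies to the left of the oriented edge; either way the square of
   the jump is the same. *)
case: (ltgtP a 0) a0 => // ha _.
  have hb : 0 < b by rewrite -(nmulr_rlt0 _ ha).
  by rewrite ltr0_sg// gtr0_sg//; ring.
have hb : b < 0 by rewrite -(pmulr_rlt0 _ ha).
by rewrite gtr0_sg// ltr0_sg//; ring.
Qed.

End Energy.

Theorem proposition5p5 (R : realType) (V : finType) (p : V -> R * R)
    (D : {set {set V}}) (u : R * R -> R)
    (hD : triangulation p D square)
    (hcont : {within square, continuous u})
    (haff : forall f : {set V}, f \in D -> affine_on u (hull p f)) :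
  exists m : 'I_3 -> 'I_3 ->
      {charge set (measurableTypeR R * measurableTypeR R)%type -> \bar R},
    [/\ (* m is a measure on the interior of the square ... *)
        vector_total_variation m (~` square°) = 0%E,
        (* ... equal to the distribution m_u ... *)
        forall phi : R * R -> R, test_function square° phi ->
          forall j k, curvature_dist u j k phi =
                      charge_integral (m j k) square° phi,
        (* ... and concentrated on the 1-skeleton *)
        vector_total_variation m (square° `\` one_skeleton p D) = 0%E
      & vector_total_variation m square° = (mean_curvature_energy p D u)%:E].
Proof.
have mI := @measurable_square_interior R.
exists (curvature_measure p D u); split.
- rewrite (curvature_total_variation u hD)//; last exact: measurableC.
  rewrite big1// => e _.
  rewrite (_ : edge_rho p e _ = 0%E) ?mul0r//.
  by apply: edge_measure_out; rewrite setICl.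
- move=> phi tphi j k; rewrite (curvature_edges hD haff _ _ tphi).
  have cphi := test_continuous tphi.
  have mphi := continuous_measurable_plane cphi.
  have [M hM] := continuous_bounded_square cphi.
  have bphi z : square° z -> `|phi z| <= M by move=> /interior_subset; exact: hM.
  rewrite /curvature_measure /comb_matrix (charge_comb_integral mI mphi bphi) big_enum.
  apply: eq_bigr => e _; congr (_ * _); rewrite (edge_measure_integral _ _ mphi bphi)//.
  by move=> z nz; exact: (test_eq0 tphi nz).
- have mS : measurable (one_skeleton p D : set (measurableTypeR R * measurableTypeR R)).
    apply: fin_bigcup_measurable; first exact: finite_finset.
    move=> e /= eD; rewrite -(edge_segmentE hD eD); exact: measurable_segment.
  rewrite (curvature_total_variation u hD)//; last exact: measurableD.
  rewrite big1// => e eD.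
  rewrite (_ : edge_rho p e _ = 0%E) ?mul0r//.
  apply: edge_measure_segmentC; apply/seteqP; split => // z [[_ nz] sz].
  by apply: nz; exists e => //; rewrite -(edge_segmentE hD eD).
- rewrite (curvature_total_variation u hD)//; congr EFin.
  rewrite /mean_curvature_energy big_mkcondr/=; apply: eq_bigr => e eD.
  exact: edge_energy.
Qed.
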